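(* Let $\mathcal{E}$ be a dense logical subtopos of a small topos $\mathcal{F}$ such that $\mathcal{F}$ admits a generic locally $\mathcal{E}$-small map. Then $(\mathcal{F}/(-))_{<\mathcal{E}}$ describes an impredicative universe in $\mathcal{F}$ in the sense of Streicher; that is, the class of locally $\mathcal{E}$-small maps of $\mathcal{F}$ is an impredicative universe in $\mathcal{F}$.
   Context: Topos means elementary topos, equipped with a choice of finite limits. A logical subtopos of a topos $\mathcal{F}$ is a full subcategory closed under a choice of topos structure (finite limits, exponentials, subobject classifier) in $\mathcal{F}$. Locally small maps: a morphism $p:E\to B$ of $\mathcal{F}$ is locally $\mathcal{E}$-small if for every $A\in\mathcal{E}$ and $f:A\to B$ there is a pullback of $p$ along $f$ whose vertex lies in $\mathcal{E}$ (by convention, the chosen pullback $f^*E$ then lies in $\mathcal{E}$). These maps are closed under pullback; $(\mathcal{F}/I)_{<\mathcal{E}}$ is the full subcategory of $\mathcal{F}/I$ on the locally $\mathcal{E}$-small maps with codomain $I$, and $(\mathcal{F}/(-))_{<\mathcal{E}}$ the resulting indexed full subcategory of $\mathcal{F}/(-)$. A generic locally $\mathcal{E}$-small map is one of which every locally $\mathcal{E}$-small map is a pullback. Let $i:\mathcal{E}\hookrightarrow\mathcal{F}$ be the inclusion. An $\mathcal{F}$-indexed category is a contravariant pseudofunctor from $\mathcal{F}$ to categories; $\mathbf{IndCat}(\mathcal{F})$ is the $2$-category of those with small values, with pseudonatural transformations and modifications; $i^*$ is precomposition with $i$. An object $X\in\mathcal{F}$ is a sheaf on $(\mathcal{F},\mathcal{E})$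 if for every $I\in\mathcal{F}$ the map $\mathrm{Hom}_{\mathcal{F}}(I,X)\to\mathrm{Nat}(\mathrm{Hom}_{\mathcal{F}}(i(-),I),\mathrm{Hom}_{\mathcal{F}}(i(-),X))$, $g\mapsto(f\mapsto g\circ f)$, is bijective. A small $\mathcal{F}$-indexed category $P$ is a stack on $(\mathcal{F},\mathcal{E})$ if for every $I\in\mathcal{F}$ the functor $P(I)\to\mathrm{Hom}_{\mathbf{IndCat}(\mathcal{E})}(i^*(\mathrm{y}I),i^*P)$ (with $\mathrm{y}I=\mathrm{Hom}_{\mathcal{F}}(-,I)$ regarded as discrete), sending $e$ to $(f:J\to I)\mapsto P(f)(e)$ with its evident coherences, is an equivalence of categories. A logical subtopos $\mathcal{E}$ of a small topos $\mathcal{F}$ is dense if (1) every object of $\mathcal{F}$ is a sheaf on $(\mathcal{F},\mathcal{E})$ and (2) the self-indexing $\mathcal{F}/(-)$ (with reindexing by pullback) is a stack on $(\mathcal{F},\mathcal{E})$. Impredicative universe (Streicher): a class of display maps in a category is a class of morphisms closed under composition with isomorphisms and such that pullbacks of its members along arbitrary morphisms exist and are again members. A class of display maps $\mathrm{E}$ in a topos $\mathcal{F}$ is an impredicative universe if (i) it is closed under composition; (ii) it contains a generic display map, i.e. a $p\in\mathrm{E}$ such that every member of $\mathrm{E}$ is a pullback of $p$; (iii) the indexed full subcategory $\mathbb{E}$ of $\mathcal{F}/(-)$, where $\mathbb{E}(I)$ is spanned by the members of $\mathrm{E}$ with codomain $I$, is an indexed logical subtopos, i.e. each $\mathbb{E}(I)$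 is a logical subtopos of $\mathcal{F}/I$ (and $\mathbb{E}$ is stable under reindexing). *)

(* Defs.v *)
From Stdlib Require Import List FinFun Classical ProofIrrelevance FunctionalExtensionality.

Set Implicit Arguments.
Unset Strict Implicit.
Unset Printing Implicit Defensive.

(** Everything below is about small categories: all types of objects and of
    morphisms live in one fixed universe, which is closed under the slice,
    functor and transformation constructions used here. *)

Record Category := {
  Obj :> Type;
  Hom : Obj -> Obj -> Type;
  idm : forall A, Hom A A;
  comp : forall A B C, Hom B C -> Hom A B -> Hom A C;
  comp_id_l : forall A B (f : Hom A B), comp (idm B) f = f;
  comp_id_r : forall A B (f : Hom A B), comp f (idm A) = f;
  comp_assoc : forall A B C D (h : Hom C D) (g : Hom B C) (f : Hom A B),
    comp h (comp g f) = comp (comp h g) f }.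

Arguments Hom {c} _ _.
Arguments idm {c} _.
Arguments comp {c A B C} _ _.

Declare Scope cat_scope.
Notation "g ∘ f" := (comp g f) (at level 40, left associativity) : cat_scope.
Open Scope cat_scope.

Definition is_iso (C : Category) (A B : C) (f : Hom A B) : Prop :=
  exists g : Hom B A, g ∘ f = idm A /\ f ∘ g = idm B.

Definition is_mono (C : Category) (A B : C) (m : Hom A B) : Prop :=
  forall (X : C) (u v : Hom X A), m ∘ u = m ∘ v -> u = v.

Record Functor (C D : Category) := {
  fob :> C -> D;
  fmap : forall A B : C, Hom A B -> Hom (fob A) (fob B);
  fmap_id : forall A : C, fmap (idm A) = idm (fob A);
  fmap_comp : forall (A B X : C) (g : Hom B X) (f : Hom A B),
    fmap (g ∘ f) = fmap g ∘ fmap f }.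

Arguments fmap {C D} _ {A B} _.

Definition id_functor (C : Category) : Functor C C :=
  {| fob := fun A => A; fmap := fun A B f => f;
     fmap_id := fun A => eq_refl; fmap_comp := fun A B X g f => eq_refl |}.

Definition comp_functor (C D X : Category) (G : Functor D X) (F : Functor C D) :
  Functor C X.
Proof.
  refine {| fob := fun A => G (F A); fmap := fun A B f => fmap G (fmap F f) |}.
  - intros A. rewrite !fmap_id. reflexivity.
  - intros A B Y g f. rewrite !fmap_comp. reflexivity.
Defined.

Record NatTrans (C D : Category) (F G : Functor C D) := {
  nt_app :> forall A : C, Hom (F A) (G A);
  nt_nat : forall (A B : C) (f : Hom A B), nt_app B ∘ fmap F f = fmap G f ∘ nt_app A }.

Record NatIso (C D : Category) (F G : Functor C D) := {
  ni_trans :> NatTrans F G;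
  ni_iso : forall A : C, is_iso (ni_trans A) }.

Definition is_equivalence (C D : Category) (F : Functor C D) : Prop :=
  exists G : Functor D C,
    inhabited (NatIso (comp_functor G F) (id_functor C)) /\
    inhabited (NatIso (comp_functor F G) (id_functor D)).

Definition discrete (X : Type) : Category.
Proof.
  refine {| Obj := X; Hom := fun x y => x = y; idm := fun x => eq_refl;
            comp := fun x y z q p => eq_trans p q |};
  intros; apply proof_irrelevance.
Defined.

Lemma discrete_hom_eq (X : Type) (x y : discrete X) (p q : Hom x y) : p = q.
Proof. exact (proof_irrelevance (x = y) p q). Qed.

Definition full_sub (C : Category) (P : C -> Prop) : Category.
Proof.
  refine {| Obj := {A : C | P A};
            Hom := fun A B => Hom (proj1_sig A) (proj1_sig B);
            idm := fun A => idm (proj1_sig A);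
            comp := fun A B X g f => g ∘ f |}; intros.
  - apply comp_id_l.
  - apply comp_id_r.
  - apply comp_assoc.
Defined.

Record SliceObj (C : Category) (I : C) := {
  sl_dom : C;
  sl_map : Hom sl_dom I }.

Record SliceHom (C : Category) (I : C) (x y : SliceObj I) := {
  sl_arr :> Hom (sl_dom x) (sl_dom y);
  sl_tri : sl_map y ∘ sl_arr = sl_map x }.

Lemma slice_hom_eq (C : Category) (I : C) (x y : SliceObj I) (u v : SliceHom x y) :
  sl_arr u = sl_arr v -> u = v.
Proof.
  destruct u as [u hu], v as [v hv]; simpl; intros e; subst v.
  f_equal; apply proof_irrelevance.
Qed.

Definition slice_id (C : Category) (I : C) (x : SliceObj I) : SliceHom x x :=
  {| sl_arr := idm (sl_dom x); sl_tri := comp_id_r (sl_map x) |}.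

Definition slice_comp (C : Category) (I : C) (x y z : SliceObj I)
  (v : SliceHom y z) (u : SliceHom x y) : SliceHom x z.
Proof.
  refine {| sl_arr := sl_arr v ∘ sl_arr u |}.
  rewrite comp_assoc, !sl_tri. reflexivity.
Defined.

Definition slice (C : Category) (I : C) : Category.
Proof.
  refine {| Obj := SliceObj I; Hom := @SliceHom C I;
            idm := @slice_id C I; comp := @slice_comp C I |};
  intros; apply slice_hom_eq; simpl.
  - apply comp_id_l.
  - apply comp_id_r.
  - apply comp_assoc.
Defined.

Definition finite_category (J : Category) : Prop :=
  Finite J /\ forall i j : J, Finite (Hom i j).

Record Cone (J C : Category) (D : Functor J C) := {
  vertex : C;
  leg : forall j : J, Hom vertex (D j);
  leg_nat : forall (i j : J) (u : Hom i j), fmap D u ∘ leg i = leg j }.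

(** The mediating morphisms are recorded as data; they are determined by the
    universal property, so this adds nothing to the choice of the limit cone. *)

Record Limit (J C : Category) (D : Functor J C) := {
  lim_cone :> Cone D;
  lim_med : forall c : Cone D, Hom (vertex c) (vertex lim_cone);
  lim_med_leg : forall (c : Cone D) (j : J), leg lim_cone j ∘ lim_med c = leg c j;
  lim_med_uniq : forall (c : Cone D) (h : Hom (vertex c) (vertex lim_cone)),
    (forall j, leg lim_cone j ∘ h = leg c j) -> h = lim_med c }.

Definition FiniteLimits (C : Category) :=
  forall J : Category, finite_category J -> forall D : Functor J C, Limit D.

Definition is_pullback (C : Category) (P A B X : C)
  (p : Hom P A) (q : Hom P B) (f : Hom A X) (g : Hom B X) : Prop :=
  f ∘ p = g ∘ q /\
  forall (W : C) (h : Hom W A) (k : Hom W B), f ∘ h = g ∘ k ->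
    exists! u : Hom W P, p ∘ u = h /\ q ∘ u = k.

Lemma finite_discrete (X : Type) : Finite X -> finite_category (discrete X).
Proof.
  intros hX; split; [exact hX|].
  intros i j; simpl.
  destruct (classic (i = j)) as [e|n].
  - exists (e :: nil). intros e'. left. apply proof_irrelevance.
  - exists nil. intros e. contradiction.
Qed.

Definition discrete_functor (X : Type) (C : Category) (D : X -> C) :
  Functor (discrete X) C.
Proof.
  refine {| fob := (D : discrete X -> C);
            fmap := fun x y (e : Hom (c := discrete X) x y) =>
              match e in (_ = z) return Hom (D x) (D z) with
              | eq_refl => idm (D x)
              end |}.
  - reflexivity.
  - intros x y z g f. destruct g, f. simpl. rewrite comp_id_l. reflexivity.
Defined.

Definition discrete_cone (X : Type) (C : Category) (D : X -> C) (W : C)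
  (l : forall x, Hom W (D x)) : Cone (discrete_functor D).
Proof.
  refine (@Build_Cone _ _ (discrete_functor D) W l _).
  intros i j u. destruct u. apply comp_id_l.
Defined.

Lemma finite_empty : Finite Empty_set.
Proof. exists nil. intros []. Qed.

Lemma finite_bool : Finite bool.
Proof. exists (true :: false :: nil). intros []; simpl; auto. Qed.

Section DerivedLimits.
Variables (C : Category) (L : FiniteLimits C).

Definition terminal_limit :=
  L (finite_discrete finite_empty)
    (discrete_functor (fun x : Empty_set => match x return C with end)).

Definition terminal : C := vertex terminal_limit.

Definition bang (A : C) : Hom A terminal :=
  lim_med terminal_limit
    (@discrete_cone Empty_set C (fun x => match x return C with end) A
       (fun x => match x with end)).

Definition prod_limit (A B : C) :=
  L (finite_discrete finite_bool) (discrete_functor (fun b : bool => if b then A else B)).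

Definition prod (A B : C) : C := vertex (prod_limit A B).
Definition pr1 (A B : C) : Hom (prod A B) A := leg (prod_limit A B) true.
Definition pr2 (A B : C) : Hom (prod A B) B := leg (prod_limit A B) false.

Definition pair (W A B : C) (f : Hom W A) (g : Hom W B) : Hom W (prod A B) :=
  lim_med (prod_limit A B)
    (@discrete_cone bool C (fun b => if b then A else B) W
       (fun b => match b return Hom W (if b then A else B) with
                 | true => f | false => g end)).

Definition prod_map_l (A A' B : C) (h : Hom A A') : Hom (prod A B) (prod A' B) :=
  pair (h ∘ pr1 A B) (pr2 A B).

End DerivedLimits.

Inductive cospan_obj := cs_left | cs_right | cs_mid.

Definition cospan_hom (x y : cospan_obj) : Type :=
  match x, y with
  | cs_left, cs_left | cs_right, cs_right | cs_mid, cs_mid => unit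
  | cs_left, cs_mid | cs_right, cs_mid => unit
  | _, _ => Empty_set
  end.

Definition cospan : Category.
Proof.
  refine {| Obj := cospan_obj; Hom := cospan_hom;
            idm := fun x => match x return cospan_hom x x with
                   | cs_left => tt | cs_right => tt | cs_mid => tt end;
            comp := fun x y z =>
              match x, y, z return
                cospan_hom y z -> cospan_hom x y -> cospan_hom x z with
              | cs_left, cs_left, cs_left => fun _ _ => tt
              | cs_left, cs_left, cs_mid => fun _ _ => tt
              | cs_left, cs_mid, cs_mid => fun _ _ => tt
              | cs_right, cs_right, cs_right => fun _ _ => tt
              | cs_right, cs_right, cs_mid => fun _ _ => tt
              | cs_right, cs_mid, cs_mid => fun _ _ => tt
              | cs_mid, cs_mid, cs_mid => fun _ _ => tt
              | cs_left, cs_right, _ => fun _ e => match e with end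
              | cs_right, cs_left, _ => fun _ e => match e with end
              | cs_mid, cs_left, _ => fun _ e => match e with end
              | cs_mid, cs_right, _ => fun _ e => match e with end
              | _, cs_left, cs_right => fun e _ => match e with end
              | _, cs_right, cs_left => fun e _ => match e with end
              | _, cs_mid, cs_left => fun e _ => match e with end
              | _, cs_mid, cs_right => fun e _ => match e with end
              end |}.
  - intros [] [] []; reflexivity.
  - intros [] [] []; reflexivity.
  - intros [] [] [] [] [] [] []; reflexivity.
Defined.

Lemma finite_cospan : finite_category cospan.
Proof.
  split.
  - exists (cs_left :: cs_right :: cs_mid :: nil). intros []; simpl; auto.
  - intros [] []; simpl;
      first [ exists nil; intros []; fail
            | exists (tt :: nil); intros []; simpl; auto ].
Qed.

Section Cospan.
Variables (C : Category) (A B X : C) (f : Hom A X) (g : Hom B X).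

Definition cospan_fob (x : cospan) : C :=
  match x with cs_left => A | cs_right => B | cs_mid => X end.

Definition cospan_fmap (x y : cospan) :
  Hom x y -> Hom (cospan_fob x) (cospan_fob y) :=
  match x, y return cospan_hom x y -> Hom (cospan_fob x) (cospan_fob y) with
  | cs_left, cs_left => fun _ => idm A
  | cs_right, cs_right => fun _ => idm B
  | cs_mid, cs_mid => fun _ => idm X
  | cs_left, cs_mid => fun _ => f
  | cs_right, cs_mid => fun _ => g
  | cs_left, cs_right => fun e => match e with end
  | cs_right, cs_left => fun e => match e with end
  | cs_mid, cs_left => fun e => match e with end
  | cs_mid, cs_right => fun e => match e with end
  end.

Definition cospan_functor : Functor cospan C.
Proof.
  refine {| fob := cospan_fob; fmap := cospan_fmap |}.
  - intros []; reflexivity.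
  - intros [] [] [] [] []; simpl;
      first [rewrite comp_id_l; reflexivity | rewrite comp_id_r; reflexivity].
Defined.

Definition cospan_cone (W : C) (h : Hom W A) (k : Hom W B) (e : f ∘ h = g ∘ k) :
  Cone cospan_functor.
Proof.
  refine (@Build_Cone _ _ cospan_functor W
            (fun j : cospan => match j return Hom W (cospan_fob j) with
                    | cs_left => h | cs_right => k | cs_mid => f ∘ h end) _).
  intros [] [] []; simpl; try apply comp_id_l.
  - reflexivity.
  - symmetry; exact e.
Defined.

Variable L : FiniteLimits C.

Definition pb_limit : Limit cospan_functor := L finite_cospan cospan_functor.

Definition pb : C := vertex pb_limit.
Definition pb1 : Hom pb A := leg pb_limit cs_left.
Definition pb2 : Hom pb B := leg pb_limit cs_right.

Lemma pb_comm : f ∘ pb1 = g ∘ pb2.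
Proof.
  transitivity (leg pb_limit cs_mid).
  - exact (@leg_nat _ _ _ pb_limit cs_left cs_mid tt).
  - symmetry. exact (@leg_nat _ _ _ pb_limit cs_right cs_mid tt).
Qed.

Definition pb_med (W : C) (h : Hom W A) (k : Hom W B) (e : f ∘ h = g ∘ k) :
  Hom W pb := lim_med pb_limit (cospan_cone e).

Lemma pb1_med (W : C) (h : Hom W A) (k : Hom W B) (e : f ∘ h = g ∘ k) :
  pb1 ∘ pb_med e = h.
Proof. exact (lim_med_leg pb_limit (cospan_cone e) cs_left). Qed.

Lemma pb2_med (W : C) (h : Hom W A) (k : Hom W B) (e : f ∘ h = g ∘ k) :
  pb2 ∘ pb_med e = k.
Proof. exact (lim_med_leg pb_limit (cospan_cone e) cs_right). Qed.

Lemma pb_uniq (W : C) (u v : Hom W pb) :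
  pb1 ∘ u = pb1 ∘ v -> pb2 ∘ u = pb2 ∘ v -> u = v.
Proof.
  intros e1 e2.
  assert (e : f ∘ (pb1 ∘ v) = g ∘ (pb2 ∘ v))
    by (rewrite !comp_assoc, pb_comm; reflexivity).
  assert (m : leg pb_limit cs_mid = f ∘ pb1)
    by (symmetry; exact (@leg_nat _ _ _ pb_limit cs_left cs_mid tt)).
  transitivity (pb_med e).
  - apply (lim_med_uniq (l := pb_limit) (c := cospan_cone e)).
    intros []; [exact e1 | exact e2 |].
    rewrite m. simpl. rewrite <- comp_assoc. f_equal. exact e1.
  - symmetry. apply (lim_med_uniq (l := pb_limit) (c := cospan_cone e)).
    intros []; [reflexivity | reflexivity |].
    rewrite m. simpl. rewrite <- comp_assoc. reflexivity.
Qed.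

Lemma pb_is_pullback : is_pullback pb1 pb2 f g.
Proof.
  split; [exact pb_comm|].
  intros W h k e. exists (pb_med e). split.
  - split; [apply pb1_med | apply pb2_med].
  - intros u [e1 e2]. apply pb_uniq.
    + rewrite pb1_med; auto.
    + rewrite pb2_med; auto.
Qed.

End Cospan.

Record ToposStructure (C : Category) := {
  ts_lim : FiniteLimits C;
  ts_exp : C -> C -> C;   (* [ts_exp A B] is [B^A] *)
  ts_ev : forall A B : C, Hom (prod ts_lim (ts_exp A B) A) B;
  ts_exp_univ : forall (A B W : C) (g : Hom (prod ts_lim W A) B),
    exists! h : Hom W (ts_exp A B), ts_ev A B ∘ prod_map_l ts_lim A h = g;
  ts_omega : C;
  ts_true : Hom (terminal ts_lim) ts_omega;
  ts_omega_univ : forall (U X : C) (m : Hom U X), is_mono m ->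
    exists! chi : Hom X ts_omega, is_pullback m (bang ts_lim U) chi ts_true }.

Record Topos := {
  topos_cat :> Category;
  topos_str : ToposStructure topos_cat }.

(** A full subcategory is given by a predicate on objects, which is not assumed
    to be invariant under isomorphism. *)

Definition closed_under (C : Category) (S : ToposStructure C) (P : C -> Prop) : Prop :=
  (forall (J : Category) (hJ : finite_category J) (D : Functor J C),
     (forall j, P (D j)) -> P (vertex (ts_lim S hJ D))) /\
  (forall A B, P A -> P B -> P (ts_exp S A B)) /\
  P (ts_omega S).

Definition is_logical_subtopos (C : Category) (P : C -> Prop) : Prop :=
  exists S : ToposStructure C, closed_under S P.

Definition cast_map (C : Category) (ob : C -> Category)
  (mp : forall I J : C, Hom I J -> Functor (ob J) (ob I))
  (I J : C) (f g : Hom I J) (e : f = g) (x : ob J) : Hom (mp I J f x) (mp I J g x) :=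
  match e in (_ = h) return Hom (mp I J f x) (mp I J h x) with
  | eq_refl => idm _
  end.

Record IndCat (C : Category) := {
  ic_ob :> C -> Category;
  ic_map : forall I J : C, Hom I J -> Functor (ic_ob J) (ic_ob I);
  ic_id : forall I : C, NatIso (id_functor (ic_ob I)) (ic_map (idm I));
  ic_comp : forall (I J K : C) (f : Hom I J) (g : Hom J K),
    NatIso (comp_functor (ic_map f) (ic_map g)) (ic_map (g ∘ f));
  ic_unit_l : forall (I J : C) (f : Hom I J) (x : ic_ob J),
    cast_map ic_map (comp_id_l f) x
      ∘ (ic_comp f (idm J) x ∘ fmap (ic_map f) (ic_id J x)) = idm _;
  ic_unit_r : forall (I J : C) (f : Hom I J) (x : ic_ob J),
    cast_map ic_map (comp_id_r f) x
      ∘ (ic_comp (idm I) f x ∘ ic_id I (ic_map f x)) = idm _;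
  ic_assoc : forall (I J K M : C) (f : Hom I J) (g : Hom J K) (h : Hom K M) (x : ic_ob M),
    cast_map ic_map (comp_assoc h g f) x
      ∘ (ic_comp (g ∘ f) h x ∘ ic_comp f g (ic_map h x))
    = ic_comp f (h ∘ g) x ∘ fmap (ic_map f) (ic_comp g h x) }.

Arguments ic_map {C} i {I J} _.
Arguments ic_id {C} i I.
Arguments ic_comp {C} i {I J K} f g.

Record PseudoNat (C : Category) (P Q : IndCat C) := {
  pn_ob : forall I : C, Functor (P I) (Q I);
  pn_map : forall (I J : C) (f : Hom I J),
    NatIso (comp_functor (ic_map Q f) (pn_ob J)) (comp_functor (pn_ob I) (ic_map P f));
  pn_id : forall (I : C) (x : P I),
    pn_map (idm I) x ∘ ic_id Q I (pn_ob I x) = fmap (pn_ob I) (ic_id P I x);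
  pn_comp : forall (I J K : C) (f : Hom I J) (g : Hom J K) (x : P K),
    pn_map (g ∘ f) x ∘ ic_comp Q f g (pn_ob K x)
    = fmap (pn_ob I) (ic_comp P f g x)
        ∘ (pn_map f (ic_map P g x) ∘ fmap (ic_map Q f) (pn_map g x)) }.

Arguments pn_map {C P Q} p {I J} _.

Record Modification (C : Category) (P Q : IndCat C) (a b : PseudoNat P Q) := {
  md_app : forall I : C, NatTrans (pn_ob a I) (pn_ob b I);
  md_nat : forall (I J : C) (f : Hom I J) (x : P J),
    md_app I (ic_map P f x) ∘ pn_map a f x
    = pn_map b f x ∘ fmap (ic_map Q f) (md_app J x) }.

Lemma nat_trans_eq (C D : Category) (F G : Functor C D) (s t : NatTrans F G) :
  (forall A, s A = t A) -> s = t.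
Proof.
  destruct s as [s hs], t as [t ht]; simpl; intros e.
  assert (s = t) by (apply functional_extensionality_dep; exact e).
  subst t. f_equal; apply proof_irrelevance.
Qed.

Lemma modification_eq (C : Category) (P Q : IndCat C) (a b : PseudoNat P Q)
  (s t : Modification a b) :
  (forall I x, md_app s I x = md_app t I x) -> s = t.
Proof.
  destruct s as [s hs], t as [t ht]; simpl; intros e.
  assert (s = t).
  { apply functional_extensionality_dep; intros I. apply nat_trans_eq, e. }
  subst t. f_equal; apply proof_irrelevance.
Qed.

Definition id_nat (C D : Category) (F : Functor C D) : NatTrans F F.
Proof.
  refine {| nt_app := fun A => idm (F A) |}.
  intros. rewrite comp_id_l, comp_id_r. reflexivity.
Defined.

Definition comp_nat (C D : Category) (F G H : Functor C D)
  (t : NatTrans G H) (s : NatTrans F G) : NatTrans F H.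
Proof.
  refine {| nt_app := fun A => t A ∘ s A |}.
  intros. rewrite <- comp_assoc, nt_nat, !comp_assoc, nt_nat. reflexivity.
Defined.

Definition id_mod (C : Category) (P Q : IndCat C) (a : PseudoNat P Q) :
  Modification a a.
Proof.
  refine {| md_app := fun I => id_nat (pn_ob a I) |}.
  intros. simpl. rewrite fmap_id, comp_id_l, comp_id_r. reflexivity.
Defined.

Definition comp_mod (C : Category) (P Q : IndCat C) (a b c : PseudoNat P Q)
  (t : Modification b c) (s : Modification a b) : Modification a c.
Proof.
  refine {| md_app := fun I => comp_nat (md_app t I) (md_app s I) |}.
  intros I J f x. simpl.
  pose proof (md_nat s f x) as hs. pose proof (md_nat t f x) as ht. simpl in hs, ht.
  rewrite fmap_comp, <- comp_assoc, hs, !comp_assoc, ht. reflexivity.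
Defined.

Definition hom_indcat (C : Category) (P Q : IndCat C) : Category.
Proof.
  refine {| Obj := PseudoNat P Q; Hom := @Modification C P Q;
            idm := @id_mod C P Q; comp := @comp_mod C P Q |};
  intros; apply modification_eq; intros; simpl.
  - apply comp_id_l.
  - apply comp_id_r.
  - apply comp_assoc.
Defined.

Definition precomp_functor (C : Category) (X I J : C) (f : Hom I J) :
  Functor (discrete (Hom J X)) (discrete (Hom I X)).
Proof.
  refine {| fob := (fun u => u ∘ f) : discrete (Hom J X) -> discrete (Hom I X);
            fmap := fun u v (e : u = v) => f_equal (fun w => w ∘ f) e |};
  intros; apply discrete_hom_eq.
Defined.

Lemma discrete_iso (X : Type) (x y : discrete X) (e : Hom x y) : is_iso e.
Proof. exists (eq_sym e). split; apply discrete_hom_eq. Qed.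

Definition discrete_nat_iso (C : Category) (X : Type) (F G : Functor C (discrete X))
  (e : forall A, F A = G A) : NatIso F G.
Proof.
  refine {| ni_trans := {| nt_app := (e : forall A : C, Hom (F A) (G A)) |} |}.
  - intros A. apply discrete_iso.
  Unshelve. intros; apply discrete_hom_eq.
Defined.

Definition yoneda (C : Category) (X : C) : IndCat C.
Proof.
  refine {| ic_ob := fun I => discrete (Hom I X);
            ic_map := fun I J f => precomp_functor X f;
            ic_id := fun I => discrete_nat_iso
              (F := id_functor _) (G := precomp_functor X (idm I))
              (fun u => eq_sym (comp_id_r u));
            ic_comp := fun I J K f g => discrete_nat_iso
              (F := comp_functor (precomp_functor X f) (precomp_functor X g))
              (G := precomp_functor X (g ∘ f))
              (fun u => eq_sym (comp_assoc u g f)) |};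
  intros; apply discrete_hom_eq.
Defined.

(** Precomposition of [P] with the inclusion of the full subcategory on [E]. *)

Definition restrict (C : Category) (E : C -> Prop) (P : IndCat C) : IndCat (full_sub E).
Proof.
  refine {| ic_ob := fun I : full_sub E => P (proj1_sig I);
            ic_map := fun (I J : full_sub E) (f : Hom I J) => ic_map P f;
            ic_id := fun I : full_sub E => ic_id P (proj1_sig I);
            ic_comp := fun (I J K : full_sub E) (f : Hom I J) (g : Hom J K) =>
              ic_comp P f g |}.
  - intros I J f x. exact (@ic_unit_l C P _ _ f x).
  - intros I J f x. exact (@ic_unit_r C P _ _ f x).
  - intros I J K M f g h x. exact (@ic_assoc C P _ _ _ _ f g h x).
Defined.

Record NatHom (C : Category) (E : C -> Prop) (I X : C) := {
  nh_app :> forall A : full_sub E, Hom (proj1_sig A) I -> Hom (proj1_sig A) X;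
  nh_nat : forall (A B : full_sub E) (h : Hom A B) (f : Hom (proj1_sig B) I),
    @nh_app A (f ∘ (h : Hom (proj1_sig A) (proj1_sig B)))
    = @nh_app B f ∘ (h : Hom (proj1_sig A) (proj1_sig B)) }.

Definition sheaf_comparison (C : Category) (E : C -> Prop) (I X : C) (g : Hom I X) :
  NatHom E I X :=
  {| nh_app := fun A f => g ∘ f;
     nh_nat := fun A B h f => comp_assoc g f h |}.

Definition is_sheaf (C : Category) (E : C -> Prop) (X : C) : Prop :=
  forall I : C, Bijective (@sheaf_comparison C E I X).

Section StackComparison.
Variables (C : Category) (E : C -> Prop) (P : IndCat C) (I : C).

Definition ev_functor (x : P I) (J : C) : Functor (discrete (Hom J I)) (P J).
Proof.
  refine {| fob := fun f : discrete (Hom J I) => ic_map P f x;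
            fmap := fun f g (e : f = g) => cast_map (@ic_map C P) e x |}.
  - reflexivity.
  - intros f g h q p. destruct q, p. simpl. rewrite comp_id_l. reflexivity.
Defined.

Definition ev_nat_iso (x : P I) (J K : C) (h : Hom J K) :
  NatIso (comp_functor (ic_map P h) (ev_functor x K))
         (comp_functor (ev_functor x J) (precomp_functor I h)).
Proof.
  unshelve refine {| ni_trans := {| nt_app := fun f : discrete (Hom K I) =>
    ic_comp P h f x : Hom (comp_functor (ic_map P h) (ev_functor x K) f)
      (comp_functor (ev_functor x J) (precomp_functor I h) f) |} |}.
  - intros f g e. destruct e. simpl. rewrite fmap_id, comp_id_l, comp_id_r. reflexivity.
  - intros f. exact (ni_iso (ic_comp P h f) x).
Defined.

Lemma cast_map_sym (J K : C) (f g : Hom J K) (e : f = g) (e' : g = f) (x : P K)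
  (Y : P J) (u : Hom Y (ic_map P f x)) (v : Hom Y (ic_map P g x)) :
  cast_map (@ic_map C P) e x ∘ u = v -> u = cast_map (@ic_map C P) e' x ∘ v.
Proof.
  destruct e. rewrite (proof_irrelevance _ e' eq_refl). simpl.
  rewrite !comp_id_l. auto.
Qed.

Definition ev_pseudonat (x : P I) :
  PseudoNat (restrict E (yoneda I)) (restrict E P).
Proof.
  refine (@Build_PseudoNat _ (restrict E (yoneda I)) (restrict E P)
            (fun J : full_sub E => ev_functor x (proj1_sig J))
            (fun (J K : full_sub E) (h : Hom J K) => ev_nat_iso x h) _ _).
  - intros J f. simpl in *.
    transitivity (cast_map (@ic_map C P) (eq_sym (comp_id_r f)) x ∘ idm _).
    + eapply cast_map_sym. apply ic_unit_r.
    + apply comp_id_r.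
  - intros J K M f g h. simpl in *.
    eapply cast_map_sym. apply ic_assoc.
Defined.

Lemma ev_mod_nat (x y : P I) (u : Hom x y) (J : C) (f g : Hom J I) (e : f = g) :
  fmap (ic_map P g) u ∘ cast_map (@ic_map C P) e x
  = cast_map (@ic_map C P) e y ∘ fmap (ic_map P f) u.
Proof. destruct e. simpl. rewrite comp_id_l, comp_id_r. reflexivity. Qed.

Definition ev_modification (x y : P I) (u : Hom x y) :
  Modification (ev_pseudonat x) (ev_pseudonat y).
Proof.
  refine (@Build_Modification _ _ _ (ev_pseudonat x) (ev_pseudonat y)
    (fun J : full_sub E =>
       @Build_NatTrans _ _ (ev_functor x (proj1_sig J)) (ev_functor y (proj1_sig J))
         (fun f : discrete (Hom (proj1_sig J) I) => fmap (ic_map P f) u)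
         (fun f g e => ev_mod_nat u e)) _).
  intros J K h f. simpl in *.
  symmetry. exact (nt_nat (ic_comp P h f) u).
Defined.

Definition stack_comparison :
  Functor (P I) (hom_indcat (restrict E (yoneda I)) (restrict E P)).
Proof.
  refine {| fob := (ev_pseudonat
              : P I -> hom_indcat (restrict E (yoneda I)) (restrict E P));
            fmap := ev_modification |}.
  - intros x. apply modification_eq; intros J f; simpl. apply fmap_id.
  - intros x y z v u. apply modification_eq; intros J f; simpl. apply fmap_comp.
Defined.

End StackComparison.

Definition is_stack (C : Category) (E : C -> Prop) (P : IndCat C) : Prop :=
  forall I : C, is_equivalence (stack_comparison E P I).

Section SelfIndexing.
Variables (C : Category) (L : FiniteLimits C).

Definition pb_obj (I J : C) (f : Hom I J) (x : slice J) : slice I :=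
  {| sl_dom := pb f (sl_map x) L; sl_map := pb1 f (sl_map x) L |}.

Definition pb_top (I J : C) (f : Hom I J) (x : slice J) :
  Hom (sl_dom (pb_obj f x)) (sl_dom x) := pb2 f (sl_map x) L.

Lemma pb_sq (I J : C) (f : Hom I J) (x : slice J) :
  f ∘ sl_map (pb_obj f x) = sl_map x ∘ pb_top f x.
Proof. apply pb_comm. Qed.

Definition pb_lift (I J : C) (f : Hom I J) (x : slice J) (w : slice I)
  (k : Hom (sl_dom w) (sl_dom x)) (e : f ∘ sl_map w = sl_map x ∘ k) :
  Hom w (pb_obj f x) :=
  @Build_SliceHom C I w (pb_obj f x) (pb_med L e) (pb1_med L e).

Lemma pb_lift_top (I J : C) (f : Hom I J) (x : slice J) (w : slice I)
  (k : Hom (sl_dom w) (sl_dom x)) (e : f ∘ sl_map w = sl_map x ∘ k) :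
  pb_top f x ∘ sl_arr (pb_lift e) = k.
Proof. apply pb2_med. Qed.

Lemma pb_lift_uniq (I J : C) (f : Hom I J) (x : slice J) (w : slice I)
  (u v : Hom w (pb_obj f x)) :
  pb_top f x ∘ sl_arr u = pb_top f x ∘ sl_arr v -> u = v.
Proof.
  intros e. apply slice_hom_eq. apply pb_uniq; [|exact e].
  etransitivity; [exact (sl_tri u) | symmetry; exact (sl_tri v)].
Qed.

Lemma pb_map_sq (I J : C) (f : Hom I J) (x y : slice J) (u : Hom x y) :
  f ∘ sl_map (pb_obj f x) = sl_map y ∘ (sl_arr u ∘ pb_top f x).
Proof. rewrite comp_assoc, sl_tri. apply pb_sq. Qed.

(** Reduces an equation between morphisms into a chosen pullback of slices to one
    between morphisms of [C] involving [pb2] and [pb_med] only. *)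
Ltac pb_reduce := apply pb_lift_uniq; cbn; unfold pb_top; cbn.

Definition pb_functor (I J : C) (f : Hom I J) : Functor (slice J) (slice I).
Proof.
  refine {| fob := pb_obj f : slice J -> slice I;
            fmap := fun x y (u : Hom x y) => pb_lift (pb_map_sq f u) |}.
  - intros x. pb_reduce. rewrite pb2_med, comp_id_l, comp_id_r. reflexivity.
  - intros x y z v u. pb_reduce.
    rewrite pb2_med, comp_assoc, pb2_med, <- !comp_assoc, pb2_med. reflexivity.
Defined.

Lemma pb_id_sq (I : C) (x : slice I) : idm I ∘ sl_map x = sl_map x ∘ idm (sl_dom x).
Proof. rewrite comp_id_l, comp_id_r. reflexivity. Qed.

Lemma pb_id_inv_sq (I : C) (x : slice I) :
  sl_map x ∘ pb_top (idm I) x = sl_map (pb_obj (idm I) x).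
Proof. rewrite <- pb_sq. apply comp_id_l. Qed.

Definition pb_id (I : C) : NatIso (id_functor (slice I)) (pb_functor (idm I)).
Proof.
  unshelve refine {| ni_trans := {| nt_app := fun x : slice I =>
    pb_lift (pb_id_sq x) : Hom (id_functor (slice I) x) (pb_functor (idm I) x) |} |}.
  - intros x y u. pb_reduce.
    rewrite !comp_assoc, !pb2_med, <- comp_assoc, pb2_med, comp_id_l, comp_id_r.
    reflexivity.
  - intros x. exists (Build_SliceHom (pb_id_inv_sq x)). split.
    + apply slice_hom_eq. cbn. unfold pb_top. apply pb2_med.
    + pb_reduce. rewrite comp_assoc, pb2_med, comp_id_l, comp_id_r. reflexivity.
Defined.

Lemma pb_comp_sq (I J K : C) (f : Hom I J) (g : Hom J K) (x : slice K) :
  (g ∘ f) ∘ sl_map (pb_obj f (pb_obj g x))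
  = sl_map x ∘ (pb_top g x ∘ pb_top f (pb_obj g x)).
Proof. rewrite <- comp_assoc, pb_sq, !comp_assoc, pb_sq. reflexivity. Qed.

Lemma pb_comp_inv_sq1 (I J K : C) (f : Hom I J) (g : Hom J K) (x : slice K) :
  g ∘ (f ∘ sl_map (pb_obj (g ∘ f) x)) = sl_map x ∘ pb_top (g ∘ f) x.
Proof. rewrite comp_assoc. apply pb_sq. Qed.

Lemma pb_comp_inv_sq2 (I J K : C) (f : Hom I J) (g : Hom J K) (x : slice K) :
  f ∘ sl_map (pb_obj (g ∘ f) x)
  = sl_map (pb_obj g x) ∘ pb_med L (pb_comp_inv_sq1 f g x).
Proof. symmetry. apply pb1_med. Qed.

Definition pb_comp (I J K : C) (f : Hom I J) (g : Hom J K) :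
  NatIso (comp_functor (pb_functor f) (pb_functor g)) (pb_functor (g ∘ f)).
Proof.
  unshelve refine {| ni_trans := {| nt_app := fun x : slice K =>
    pb_lift (pb_comp_sq f g x)
      : Hom (comp_functor (pb_functor f) (pb_functor g) x) (pb_functor (g ∘ f) x) |} |}.
  - intros x y u. pb_reduce.
    rewrite !comp_assoc, !pb2_med, <- !comp_assoc, !pb2_med, !comp_assoc, pb2_med.
    reflexivity.
  - intros x. exists (pb_lift (pb_comp_inv_sq2 f g x)). split.
    + pb_reduce. rewrite comp_assoc, pb2_med, comp_id_r. apply pb_uniq.
      * rewrite comp_assoc, pb1_med, <- comp_assoc, pb1_med. apply pb_comm.
      * rewrite comp_assoc, !pb2_med. reflexivity.
    + pb_reduce.
      rewrite comp_assoc, pb2_med, <- comp_assoc, !pb2_med, comp_id_r. reflexivity.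
Defined.

Lemma pb_cast_top (I J : C) (f g : Hom I J) (e : f = g) (x : slice J) :
  @comp C (pb f (sl_map x) L) _ _ (pb2 g (sl_map x) L)
    (@sl_arr C I (pb_obj f x) (pb_obj g x) (@cast_map C (@slice C) pb_functor I J f g e x))
  = pb2 f (sl_map x) L.
Proof. destruct e. apply comp_id_r. Qed.

Definition self_indexing : IndCat C.
Proof.
  refine {| ic_ob := fun I => slice I; ic_map := pb_functor;
            ic_id := pb_id; ic_comp := pb_comp |}.
  - intros I J f x. pb_reduce.
    rewrite !comp_assoc, pb_cast_top, pb2_med, <- comp_assoc, pb2_med, comp_assoc,
      pb2_med, comp_id_l, comp_id_r.
    reflexivity.
  - intros I J f x. pb_reduce.
    rewrite !comp_assoc, pb_cast_top, pb2_med, <- comp_assoc, pb2_med. reflexivity.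
  - intros I J K M f g h x. pb_reduce.
    rewrite (comp_assoc (pb2 _ _ _)), pb_cast_top.
    repeat rewrite ?(comp_assoc (pb2 _ _ _) (pb_med _ _)), ?pb2_med,
      <- ?(comp_assoc (pb2 _ _ _) (pb2 _ _ _)).
    reflexivity.
Defined.

End SelfIndexing.

Definition topos_self_indexing (F : Topos) : IndCat F :=
  self_indexing (ts_lim (topos_str F)).

Definition is_dense_logical_subtopos (F : Topos) (E : F -> Prop) : Prop :=
  is_logical_subtopos E /\
  (forall X : F, is_sheaf E X) /\
  is_stack E (topos_self_indexing F).

Definition MapClass (C : Category) := forall A B : C, Hom A B -> Prop.

(** The pullback with vertex in [E] need not be the one chosen in the topos
    structure of the ambient category. *)

Definition locally_small (C : Category) (E : C -> Prop) : MapClass C :=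
  fun X B p => forall (A : C) (f : Hom A B), E A ->
    exists (V : C) (q : Hom V A) (k : Hom V X), E V /\ is_pullback q k f p.

Definition is_generic (C : Category) (D : MapClass C) (X B : C) (p : Hom X B) : Prop :=
  D X B p /\
  forall (Y A : C) (q : Hom Y A), D Y A q ->
    exists (f : Hom A B) (k : Hom Y X), is_pullback q k f p.

Definition has_generic (C : Category) (D : MapClass C) : Prop :=
  exists (X B : C) (p : Hom X B), is_generic D p.

Definition is_display_class (C : Category) (D : MapClass C) : Prop :=
  (forall (X' X B : C) (p : Hom X B) (u : Hom X' X), is_iso u -> D X B p -> D X' B (p ∘ u)) /\
  (forall (X B B' : C) (p : Hom X B) (v : Hom B B'), is_iso v -> D X B p -> D X B' (v ∘ p)) /\
  (forall (X B A : C) (p : Hom X B) (f : Hom A B), D X B p ->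
     exists (V : C) (q : Hom V A) (k : Hom V X), is_pullback q k f p) /\
  (forall (X B A V : C) (p : Hom X B) (f : Hom A B) (q : Hom V A) (k : Hom V X),
     D X B p -> is_pullback q k f p -> D V A q).

Definition class_fiber (C : Category) (D : MapClass C) (I : C) : slice I -> Prop :=
  fun x => D (sl_dom x) I (sl_map x).

Definition is_indexed_logical_subtopos (F : Topos) (D : MapClass F) : Prop :=
  (forall I : F, is_logical_subtopos (class_fiber D (I := I))) /\
  (forall (I J : F) (f : Hom I J) (x : slice J),
     class_fiber D x -> class_fiber D (ic_map (topos_self_indexing F) f x)).

Definition is_impredicative_universe (F : Topos) (D : MapClass F) : Prop :=
  is_display_class D /\
  (forall (X Y Z : F) (p : Hom X Y) (q : Hom Y Z), D X Y p -> D Y Z q -> D X Z (q ∘ p)) /\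
  has_generic D /\
  is_indexed_logical_subtopos D.

(* Main.v *)
From Stdlib Require Import ssreflect List ClassicalEpsilon.
Require Import Defs.

Set Implicit Arguments.
Unset Strict Implicit.
Unset Printing Implicit Defensive.

(** Write [S] for a topos structure under which [E] is closed. Being locally
    small is a statement about pullbacks, so pasting of pullback squares shows
    that locally small maps are stable under pullback, contain the isomorphisms
    and compose ([locally_small_pullback], [locally_small_iso],
    [locally_small_comp]). A generic locally small map is given. What has to be
    proved is that the locally small maps into [I] form a logical subtopos of the
    slice over [I].

    The reason is that finite limits, exponentials and the subobject classifier
    of a slice are stable under base change. Let [x] be one of them, formed over
    [I] from locally small maps, and let [f : A -> I] with [A] in [E]. Pull the
    data back along [f] to maps into [A] whose domains lie in [E], and carry out
    the same construction over [A], using [S]: as [A] and those domains lie in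
    [E], so does the domain of the result, and by stability that result is a
    pullback of [x] along [f]. This is done for finite limits in
    [locally_small_slice_lim], for exponentials in [locally_small_slice_exp] and
    for the classifier [I * Omega -> I] in [locally_small_slice_omega].

    The argument needs the fundamental theorem of topos theory (a slice of a topos
    is a topos, [slice_topos]) in a form that records where the constructed
    objects live. A finite limit in the slice over [I] is a limit in the ambient
    category of the same diagram with [I] adjoined as a terminal vertex. An
    exponential of [p : X -> I] and [q : Y -> I] is the subobject of
    [I * Omega^(X * Y)] consisting of the pairs [(a, R)] such that [R] is the graph
    of a map from the fibre of [p] to the fibre of [q] over [a]
    ([slice_exp_exists]). It is cut out with generalized elements: a predicate on
    the generalized elements of an object is representable if it is the
    factorization through a monomorphism, and representable predicates contain
    equality, membership and being a singleton, and are closed under substitution,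
    conjunction and universal quantification. Each closure property takes its
    representing object from [S], hence stays inside every class of objects closed
    under [S]; the class of all objects gives the topos structure of the slices,
    and the class [E] gives the smallness of exponentials. *)

(** * Pullbacks and products *)

Section Pullbacks.
Variable C : Category.

Lemma is_pullback_intro (P A B X : C) (p : Hom P A) (q : Hom P B)
  (f : Hom A X) (g : Hom B X) :
  f ∘ p = g ∘ q ->
  (forall W (h : Hom W A) (k : Hom W B), f ∘ h = g ∘ k ->
     exists u, p ∘ u = h /\ q ∘ u = k) ->
  (forall W (u v : Hom W P), p ∘ u = p ∘ v -> q ∘ u = q ∘ v -> u = v) ->
  is_pullback p q f g.
Proof.
move=> e ex un; split=> // W h k e'.
have [u [e1 e2]] := ex W h k e'.
by exists u; split=> // v [e3 e4]; apply: un; rewrite ?e1 ?e2.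
Qed.

Lemma pullback_lift (P A B X : C) (p : Hom P A) (q : Hom P B)
  (f : Hom A X) (g : Hom B X) W (h : Hom W A) (k : Hom W B) :
  is_pullback p q f g -> f ∘ h = g ∘ k ->
  {u : Hom W P | p ∘ u = h /\ q ∘ u = k}.
Proof.
move=> [_ pb] e; apply: constructive_indefinite_description.
by have [u [eu _]] := pb W h k e; exists u.
Qed.

Lemma pullback_ext (P A B X : C) (p : Hom P A) (q : Hom P B)
  (f : Hom A X) (g : Hom B X) W (u v : Hom W P) :
  is_pullback p q f g -> p ∘ u = p ∘ v -> q ∘ u = q ∘ v -> u = v.
Proof.
move=> [e pb] e1 e2.
have [|w [_ un]] := pb W (p ∘ v) (q ∘ v); first by rewrite !comp_assoc e.
by rewrite -(un u) ?(un v).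
Qed.

Lemma is_pullback_sym (P A B X : C) (p : Hom P A) (q : Hom P B)
  (f : Hom A X) (g : Hom B X) :
  is_pullback p q f g -> is_pullback q p g f.
Proof.
move=> pb; apply: is_pullback_intro; first by rewrite (proj1 pb).
- move=> W h k e.
  by have [u [e1 e2]] := pullback_lift pb (eq_sym e); exists u.
- by move=> W u v e1 e2; apply: (pullback_ext pb).
Qed.

Lemma pullback_paste (P A B X P' A' : C) (p : Hom P A) (q : Hom P B)
  (f : Hom A X) (g : Hom B X) (p' : Hom P' A') (q' : Hom P' P) (f' : Hom A' A) :
  is_pullback p q f g -> is_pullback p' q' f' p ->
  is_pullback p' (q ∘ q') (f ∘ f') g.
Proof.
move=> pb pb'; apply: is_pullback_intro.
- by rewrite -comp_assoc (proj1 pb') !comp_assoc (proj1 pb).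
- move=> W h k e.
  have [|u [e1 e2]] := pullback_lift (h := f' ∘ h) (k := k) pb.
    by rewrite comp_assoc.
  have [v [e3 e4]] := pullback_lift pb' (eq_sym e1).
  by exists v; rewrite -comp_assoc e4.
- move=> W u v e1 e2; apply: (pullback_ext pb') => //.
  apply: (pullback_ext pb); last by rewrite !comp_assoc.
  by rewrite !comp_assoc -(proj1 pb') -!comp_assoc e1.
Qed.

Lemma pullback_mono (P A B X : C) (p : Hom P A) (q : Hom P B)
  (f : Hom A X) (g : Hom B X) :
  is_pullback p q f g -> is_mono g -> is_mono p.
Proof.
move=> pb mg W u v e; apply: (pullback_ext pb) => //.
by apply: mg; rewrite !comp_assoc -(proj1 pb) -!comp_assoc e.
Qed.

Lemma limit_ext (J : Category) (D : Functor J C) (l : Limit D) W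
  (u v : Hom W (vertex l)) :
  (forall j, leg l j ∘ u = leg l j ∘ v) -> u = v.
Proof.
move=> e.
have nat i j (w : Hom i j) : fmap D w ∘ (leg l i ∘ v) = leg l j ∘ v.
  by rewrite comp_assoc leg_nat.
pose c := Build_Cone nat.
by rewrite (@lim_med_uniq _ _ _ l c u) // (@lim_med_uniq _ _ _ l c v).
Qed.

Variable L : FiniteLimits C.

Lemma bang_ext W (u v : Hom W (terminal L)) : u = v.
Proof. by apply: limit_ext; case. Qed.

Lemma pr1_pair W A B (f : Hom W A) (g : Hom W B) : pr1 L A B ∘ pair L f g = f.
Proof.
exact: (lim_med_leg (prod_limit L A B) (discrete_cone _) true).
Qed.

Lemma pr2_pair W A B (f : Hom W A) (g : Hom W B) : pr2 L A B ∘ pair L f g = g.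
Proof.
exact: (lim_med_leg (prod_limit L A B) (discrete_cone _) false).
Qed.

Lemma prod_ext W A B (u v : Hom W (prod L A B)) :
  pr1 L A B ∘ u = pr1 L A B ∘ v -> pr2 L A B ∘ u = pr2 L A B ∘ v -> u = v.
Proof. by move=> e1 e2; apply: limit_ext; case. Qed.

Lemma pair_comp V W A B (f : Hom W A) (g : Hom W B) (s : Hom V W) :
  pair L f g ∘ s = pair L (f ∘ s) (g ∘ s).
Proof.
by apply: prod_ext; rewrite comp_assoc ?pr1_pair ?pr2_pair.
Qed.

Lemma pair_eta W A B (u : Hom W (prod L A B)) :
  pair L (pr1 L A B ∘ u) (pr2 L A B ∘ u) = u.
Proof. by apply: prod_ext; rewrite ?pr1_pair ?pr2_pair. Qed.

Lemma pair_inj W A B (f f' : Hom W A) (g g' : Hom W B) :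
  pair L f g = pair L f' g' -> f = f' /\ g = g'.
Proof.
move=> e; split.
- by rewrite -(pr1_pair f g) e pr1_pair.
- by rewrite -(pr2_pair f g) e pr2_pair.
Qed.

End Pullbacks.

(** * Generalized elements of the subobject classifier and of power objects *)

Section Elements.
Variables (C : Category) (S : ToposStructure C).
Let L := ts_lim S.

Definition truth (T : C) : Hom T (ts_omega S) := ts_true S ∘ bang L T.

Lemma truth_comp T T' (s : Hom T' T) : truth T ∘ s = truth T'.
Proof. by rewrite /truth -comp_assoc; congr (_ ∘ _); apply: bang_ext. Qed.

Lemma truth_eq T (k : Hom T (terminal L)) : ts_true S ∘ k = truth T.
Proof. by congr (_ ∘ _); apply: bang_ext. Qed.

(** Being the characteristic map of [m], read on generalized elements: [chi] is
    true exactly on the elements that factor through [m]. *)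
Lemma omega_classify U T (m : Hom U T) (chi : Hom T (ts_omega S)) :
  is_pullback m (bang L U) chi (ts_true S) <->
  is_mono m /\
  (forall T' (s : Hom T' T), chi ∘ s = truth T' <-> exists c, m ∘ c = s).
Proof.
split=> [pb|[mm ax]].
- have mt : is_mono (ts_true S) by move=> W u v _; apply: bang_ext.
  split=> [|T' s]; first exact: pullback_mono pb mt.
  split=> [e|[c <-]].
  + by have [c [ec _]] := pullback_lift pb e; exists c.
  + by rewrite comp_assoc (proj1 pb) truth_comp.
- apply: is_pullback_intro.
  + by apply/ax; exists (idm U); rewrite comp_id_r.
  + move=> W h k; rewrite truth_eq => /ax [c ec].
    by exists c; split=> //; apply: bang_ext.
  + by move=> W u v e _; apply: mm.
Qed.

(** Maps to the classifier that are true on the same elements classify the same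
    subobject, namely the pullback of [true] along either of them. *)
Lemma omega_ext T (chi chi' : Hom T (ts_omega S)) :
  (forall T' (s : Hom T' T), chi ∘ s = truth T' <-> chi' ∘ s = truth T') ->
  chi = chi'.
Proof.
move=> e.
pose m := pb1 chi (ts_true S) L.
have pb : is_pullback m (bang L _) chi (ts_true S).
  have := pb_is_pullback chi (ts_true S) L.
  by rewrite (bang_ext (pb2 _ _ _) (bang L _)).
have [mm ax] := proj1 (omega_classify _ _) pb.
have pb' : is_pullback m (bang L _) chi' (ts_true S).
  by apply/omega_classify; split=> // T' s; rewrite -e.
have [c [_ un]] := ts_omega_univ S mm.
by rewrite -(un _ pb) (un _ pb').
Qed.

Lemma omega_comprehension U T (m : Hom U T) : is_mono m ->
  exists chi : Hom T (ts_omega S),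
    forall T' (s : Hom T' T), chi ∘ s = truth T' <-> exists c, m ∘ c = s.
Proof.
move=> mm; have [chi [pb _]] := ts_omega_univ S mm.
by exists chi; apply: proj2 (proj1 (omega_classify _ _) pb).
Qed.

Definition power (X : C) : C := ts_exp S X (ts_omega S).

Definition mem T X (u : Hom T (power X)) (x : Hom T X) : Prop :=
  ts_ev S X (ts_omega S) ∘ pair L u x = truth T.

Lemma ev_prod_map T T' X B (h : Hom T (ts_exp S X B)) (w : Hom T' (prod L T X)) :
  ts_ev S X B ∘ prod_map_l L X h ∘ w
  = ts_ev S X B ∘ pair L (h ∘ (pr1 L T X ∘ w)) (pr2 L T X ∘ w).
Proof. by rewrite -comp_assoc /prod_map_l pair_comp !comp_assoc. Qed.

Lemma power_ext T X (u v : Hom T (power X)) :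
  (forall T' (s : Hom T' T) (x : Hom T' X), mem (u ∘ s) x <-> mem (v ∘ s) x) ->
  u = v.
Proof.
move=> e.
have [w [_ un]] := ts_exp_univ (ts_ev S X (ts_omega S) ∘ prod_map_l L X v).
rewrite -(un v) // -(un u) //.
apply: omega_ext => T' s; rewrite !ev_prod_map; exact: e.
Qed.

Lemma power_comprehension U T X (m : Hom U (prod L T X)) : is_mono m ->
  exists u : Hom T (power X), forall T' (s : Hom T' T) (x : Hom T' X),
    mem (u ∘ s) x <-> exists c, m ∘ c = pair L s x.
Proof.
move=> /omega_comprehension [chi ax].
have [u [eu _]] := ts_exp_univ chi.
exists u => T' s x.
rewrite -ax -eu ev_prod_map pr1_pair pr2_pair; reflexivity.
Qed.

End Elements.

(** * Representable predicates *)

Section Representable.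
Variables (C : Category) (S : ToposStructure C) (P : C -> Prop).
Hypothesis closed : closed_under S P.
Let L := ts_lim S.

Lemma closed_prod A B : P A -> P B -> P (prod L A B).
Proof. by move=> hA hB; apply: (proj1 closed); case. Qed.

Lemma closed_pb A B X (f : Hom A X) (g : Hom B X) :
  P A -> P B -> P X -> P (pb f g L).
Proof. by move=> hA hB hX; apply: (proj1 closed); case. Qed.

Lemma closed_power X : P X -> P (power S X).
Proof.
by move=> hX; apply: (proj1 (proj2 closed)) => //; apply: (proj2 (proj2 closed)).
Qed.

(** For a representable predicate, stability under restriction along maps
    [T' -> T] is automatic. *)
Definition predicate (B : C) := forall T, Hom T B -> Prop.

Definition representable (B : C) (phi : predicate B) : Prop :=
  exists (Z : C) (n : Hom Z B), P Z /\ is_mono n /\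
    forall T (b : Hom T B), phi T b <-> exists c, n ∘ c = b.

Lemma representable_iff B (phi psi : predicate B) :
  (forall T b, phi T b <-> psi T b) -> representable phi -> representable psi.
Proof.
move=> e [Z [n [hZ [mn ax]]]]; exists Z, n; split=> //; split=> // T b.
by rewrite -e.
Qed.

(** The equalizer of [f] and [g], written as the pullback of their graphs. *)
Lemma representable_eq B D (f g : Hom B D) : P B -> P D ->
  representable (fun T b => f ∘ b = g ∘ b).
Proof.
move=> hB hD.
pose f' := pair L (idm B) f; pose g' := pair L (idm B) g.
have pbE := pb_is_pullback f' g' L.
have key W (u v : Hom W B) : f' ∘ u = g' ∘ v <-> u = v /\ f ∘ u = g ∘ v.
  rewrite /f' /g' !pair_comp !comp_id_l; split; first exact: pair_inj.
  by case=> -> ->.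
exists (pb f' g' L), (pb1 f' g' L); split; last split.
- by apply: closed_pb => //; apply: closed_prod.
- move=> W u v e; apply: (pullback_ext pbE) => //.
  by have [<- _] := proj1 (key _ _ _) (proj1 pbE).
- move=> T b; split=> [e|[c <-]].
  + have [|c [ec _]] := pullback_lift (h := b) (k := b) pbE; first by apply/key.
    by exists c.
  + have [e1 e2] := proj1 (key _ _ _) (proj1 pbE).
    by rewrite !comp_assoc e2 -e1.
Qed.

Lemma representable_subst B' B (f : Hom B' B) (phi : predicate B) :
  P B' -> P B -> representable phi -> representable (fun T b => phi T (f ∘ b)).
Proof.
move=> hB' hB [Z [n [hZ [mn ax]]]].
have pbE := pb_is_pullback f n L.
exists (pb f n L), (pb1 f n L); split; first exact: closed_pb.
split; first exact: pullback_mono pbE mn.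
move=> T b; rewrite ax; split=> [[c ec]|[c <-]].
- by have [d [ed _]] := pullback_lift pbE (eq_sym ec); exists d.
- by exists (pb2 f n L ∘ c); rewrite !comp_assoc (proj1 pbE).
Qed.

Lemma representable_and B (phi psi : predicate B) : P B ->
  representable phi -> representable psi ->
  representable (fun T b => phi T b /\ psi T b).
Proof.
move=> hB [Z [n [hZ [mn ax]]]] [Z' [n' [hZ' [mn' ax']]]].
have pbE := pb_is_pullback n n' L.
exists (pb n n' L), (n ∘ pb1 n n' L); split; first exact: closed_pb.
split.
  move=> W u v; rewrite -!comp_assoc => /mn; exact: pullback_mono pbE mn' _ _ _.
move=> T b; rewrite ax ax'; split=> [[[c ec] [c' ec']]|[c <-]].
- have [|d [ed _]] := pullback_lift (h := c) (k := c') pbE.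
    by rewrite ec ec'.
  by exists d; rewrite -comp_assoc ed.
- split; first by exists (pb1 n n' L ∘ c); rewrite comp_assoc.
  by exists (pb2 n n' L ∘ c); rewrite comp_assoc -(proj1 pbE).
Qed.

(** Membership is the equation saying that the evaluation is [true]. *)
Lemma representable_mem B X (u : Hom B (power S X)) (x : Hom B X) : P B ->
  representable (fun T b => mem (u ∘ b) (x ∘ b)).
Proof.
move=> hB.
apply: (representable_iff _ (representable_eq
  (ts_ev S X (ts_omega S) ∘ pair L u x) (truth S B) hB _)).
- by move=> T b; rewrite truth_comp -comp_assoc pair_comp.
- exact: (proj2 (proj2 closed)).
Qed.

Lemma comprehension B X (phi : predicate (prod L B X)) :
  representable phi -> exists u : Hom B (power S X),
  forall T (s : Hom T B) (x : Hom T X), mem (u ∘ s) x <-> phi T (pair L s x).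
Proof.
move=> [Z [n [_ [mn ax]]]].
have [u eu] := power_comprehension mn.
by exists u => T s x; rewrite ax.
Qed.

(** The subsets of [X] cut out by [phi] and by [phi /\ psi] define two maps from
    [B] to the power object of [X], which agree at [b] exactly when [phi] implies
    [psi] over [b]. Quantification over all stages [T'] is what makes the statement
    the internal universal quantifier. *)
Lemma representable_forall B X (phi psi : predicate (prod L B X)) :
  P B -> P X -> representable phi -> representable psi ->
  representable (fun T b => forall T' (s : Hom T' T) (x : Hom T' X),
    phi T' (pair L (b ∘ s) x) -> psi T' (pair L (b ∘ s) x)).
Proof.
move=> hB hX hphi hpsi.
have [u eu] := comprehension hphi.
have [v ev] := comprehension (representable_and (closed_prod hB hX) hphi hpsi).
apply: (representable_iff _ (representable_eq u v hB (closed_power hX))).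
move=> T b; split=> [e T' s x|e].
- by rewrite -eu comp_assoc e -comp_assoc ev; case.
- apply: power_ext => T' s x; rewrite -!comp_assoc eu ev.
  by split=> [h|[]] //; split=> //; apply: e.
Qed.

(** The monomorphism representing this predicate is the singleton map from [Y] to
    its power object. *)
Lemma representable_singleton Y : P Y ->
  representable (B := power S Y) (fun T u => exists y : Hom T Y,
    forall T' (s : Hom T' T) (y' : Hom T' Y), mem (u ∘ s) y' <-> y' = y ∘ s).
Proof.
move=> hY.
have [sg esg] := comprehension (representable_eq (pr1 L Y Y) (pr2 L Y Y)
  (closed_prod hY hY) hY).
have {}esg T (s y : Hom T Y) : mem (sg ∘ s) y <-> y = s.
  rewrite esg pr1_pair pr2_pair; split; exact: eq_sym.
exists Y, sg; split=> //; split.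
- by move=> W u v e; apply/esg; rewrite -e; apply/esg.
- move=> T u; split=> [[y ey]|[y <-]]; exists y.
  + by apply: power_ext => T' s y'; rewrite -comp_assoc esg ey.
  + by move=> T' s y'; rewrite -comp_assoc.
Qed.

End Representable.

(** * Exponentials in slices *)

Section SliceExponentials.
Variable C : Category.

(** The universal property of the exponential [q^p] over [I], expressed in [C]: a
    product in the slice is a pullback, so [W] stands for the product of [r] and
    [p], and [Q] for that of [t] and [p]. Arbitrary pullbacks are allowed here, so
    that the property can be transported along base change by pasting. *)
Definition is_slice_exp (I X Y Z W : C) (p : Hom X I) (q : Hom Y I) (r : Hom Z I)
  (w1 : Hom W Z) (w2 : Hom W X) (ev : Hom W Y) : Prop :=
  q ∘ ev = p ∘ w2 /\
  forall (T Q : C) (t : Hom T I) (a : Hom Q T) (b : Hom Q X),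
    is_pullback a b t p -> forall g : Hom Q Y, q ∘ g = p ∘ b ->
    exists! h : Hom T Z, r ∘ h = t /\
      forall k : Hom Q W, w1 ∘ k = h ∘ a -> w2 ∘ k = b -> ev ∘ k = g.

Section Construction.
Variables (S : ToposStructure C) (P : C -> Prop).
Hypothesis closed : closed_under S P.
Let L := ts_lim S.
Variables (I X Y : C) (p : Hom X I) (q : Hom Y I).
Hypotheses (hI : P I) (hX : P X) (hY : P Y).

Let XY := prod L X Y.
Let B := prod L I (power S XY).

(** [R] is the graph of a map from the fibre of [p] over [a] to the fibre of [q]
    over [a]. Existence of a unique [y] related to [x] is phrased as the set of
    such [y] being a singleton, which makes the uniqueness hold at all later
    stages. *)
Definition is_fibre_graph T (a : Hom T I) (R : Hom T (power S XY)) : Prop :=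
  (forall T' (s : Hom T' T) (xy : Hom T' XY), mem (R ∘ s) xy ->
     p ∘ (pr1 L X Y ∘ xy) = a ∘ s /\ q ∘ (pr2 L X Y ∘ xy) = a ∘ s) /\
  (forall T' (s : Hom T' T) (x : Hom T' X), p ∘ x = a ∘ s ->
     exists y : Hom T' Y, forall T'' (s' : Hom T'' T') (y' : Hom T'' Y),
       mem (R ∘ s ∘ s') (pair L (x ∘ s') y') <-> y' = y ∘ s').

Lemma representable_fibre_graph :
  representable P (B := B)
    (fun T b => is_fibre_graph (pr1 L _ _ ∘ b) (pr2 L _ _ ∘ b)).
Proof.
have hXY : P XY by apply: (closed_prod closed).
have hN : P (power S XY) by apply: (closed_power closed).
have hB : P B by apply: (closed_prod closed).
have hBX : P (prod L B X) by apply: (closed_prod closed).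
have hBXY : P (prod L B XY) by apply: (closed_prod closed).
have hBXoY : P (prod L (prod L B X) Y) by apply: (closed_prod closed).
apply: (representable_and closed) => //.
- (* [R] is contained in the fibre over [a] of the map to [I] on both sides. *)
  pose a := pr1 L I _ ∘ pr1 L B XY.
  have hmem := representable_mem closed (pr2 L I _ ∘ pr1 L B XY) (pr2 L B XY) hBXY.
  have e1 := representable_eq closed (p ∘ (pr1 L X Y ∘ pr2 L B XY)) a hBXY hI.
  have e2 := representable_eq closed (q ∘ (pr2 L X Y ∘ pr2 L B XY)) a hBXY hI.
  apply: (representable_iff _ (representable_forall closed hB hXY hmem
    (representable_and closed hBXY e1 e2))) => T b.
  rewrite /a.
  by split=> h T' s xy; have := h T' s xy;
    rewrite -?comp_assoc ?pr1_pair ?pr2_pair.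
- (* [rho (b, x)] is the set of the [y] related to [x] by the relation in [b]. *)
  have [rho erho] := comprehension (representable_mem closed
    (pr2 L I _ ∘ (pr1 L B X ∘ pr1 L (prod L B X) Y))
    (pair L (pr2 L B X ∘ pr1 L (prod L B X) Y) (pr2 L (prod L B X) Y)) hBXoY).
  have {}erho T (s : Hom T B) (x : Hom T X) (y : Hom T Y) :
      mem (rho ∘ pair L s x) y <-> mem (pr2 L I _ ∘ s) (pair L x y).
    by rewrite erho pair_comp -!comp_assoc !pr1_pair !pr2_pair.
  have hsg := representable_subst closed rho hBX (closed_power closed hY)
    (representable_singleton closed hY).
  have e1 := representable_eq closed (p ∘ pr2 L B X) (pr1 L I _ ∘ pr1 L B X) hBX hI.
  apply: (representable_iff _ (representable_forall closed hB hX e1 hsg)) => T b.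
  have memE T' (s : Hom T' T) (x : Hom T' X) T'' (s' : Hom T'' T') (y : Hom T'' Y) :
      mem (rho ∘ pair L (b ∘ s) x ∘ s') y
      <-> mem (pr2 L I _ ∘ b ∘ s ∘ s') (pair L (x ∘ s') y).
    by rewrite -comp_assoc pair_comp erho -!comp_assoc.
  split=> h T' s x e; have [|y ey] := h T' s x; try by
    move: e; rewrite -!comp_assoc pr1_pair pr2_pair.
  + by exists y => T'' s' y'; rewrite -memE.
  + by exists y => T'' s' y'; rewrite memE.
Qed.

(** An element of [Z] over [t : T -> I] is a fibre graph on [t]. From a map
    [g : Q -> Y] over [I], with [Q] the product of [t] and [p], one obtains the
    graph of [g] as a subobject of [T * (X * Y)], hence a relation [R] over [T],
    and conversely [ev] reads off the value from the singleton condition. *)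
Lemma slice_exp_exists :
  exists (Z : C) (r : Hom Z I), P Z /\
    forall W (w1 : Hom W Z) (w2 : Hom W X), is_pullback w1 w2 r p ->
      exists ev : Hom W Y, is_slice_exp p q r w1 w2 ev.
Proof.
have [Z [n [hZ [mn ax]]]] := representable_fibre_graph.
pose r := pr1 L I (power S XY) ∘ n; pose gr := pr2 L I (power S XY) ∘ n.
have graphZ T (h : Hom T Z) : is_fibre_graph (r ∘ h) (gr ∘ h).
  by have := proj2 (ax T (n ∘ h)); rewrite !comp_assoc; apply; exists h.
have liftZ T (a : Hom T I) (R : Hom T (power S XY)) : is_fibre_graph a R ->
    exists h : Hom T Z, r ∘ h = a /\ gr ∘ h = R.
  move=> gR; have [|h eh] := proj1 (ax T (pair L a R)).
    by rewrite pr1_pair pr2_pair.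
  by exists h; rewrite /r /gr -!comp_assoc eh pr1_pair pr2_pair.
have extZ T (h h' : Hom T Z) : r ∘ h = r ∘ h' -> gr ∘ h = gr ∘ h' -> h = h'.
  by rewrite /r /gr -!comp_assoc => e1 e2; apply: mn; apply: prod_ext.
have [gr1 gr2] := graphZ Z (idm Z).
move: gr1 gr2; rewrite !comp_id_r => gr1 gr2.
exists Z, r; split=> // W w1 w2 pbW.
have [ev eev] := gr2 W w1 w2 (eq_sym (proj1 pbW)).
exists ev; split.
  have [|_] := gr1 W w1 (pair L w2 ev).
    by have := eev W (idm W) ev; rewrite !comp_id_r => ->.
  by rewrite pr2_pair => ->; apply: (proj1 pbW).
move=> T Q t a b pbQ g eg.
have mm : is_mono (pair L a (pair L b g)).
  move=> V u v; rewrite !pair_comp => /pair_inj [e1 /pair_inj [e2 _]].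
  exact: (pullback_ext pbQ).
have [R eR] := power_comprehension mm.
(* Membership in [R] at stage [T'] is membership in the graph of [g]. *)
have memR T' (e : Hom T' Q) (y : Hom T' Y) :
    mem (R ∘ (a ∘ e)) (pair L (b ∘ e) y) <-> y = g ∘ e.
  rewrite eR; split=> [[c]|->]; last by exists e; rewrite !pair_comp.
  rewrite !pair_comp => /pair_inj [e1 /pair_inj [e2 <-]].
  by rewrite (pullback_ext pbQ e1 e2).
have gR : is_fibre_graph t R.
  split=> [T' s xy|T' s x e]; last first.
    have [c [<- <-]] := pullback_lift pbQ (eq_sym e).
    by exists (g ∘ c) => T'' s' y'; rewrite -!comp_assoc memR.
  rewrite eR => [[c]]; rewrite !pair_comp => /pair_inj [<- <-].
  by rewrite pr1_pair pr2_pair !comp_assoc eg (proj1 pbQ).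
have [h [rh grh]] := liftZ _ _ _ gR.
exists h; split.
  split=> // k e1 e2; symmetry.
  have := eev Q k g; rewrite -comp_assoc e1 e2 comp_assoc grh => <-.
  by have := memR Q (idm Q) g; rewrite !comp_id_r => ->.
(* An [h'] with the same values as [g] has the same relation as [h]: on pairs
   [(x, y)] with [x] in the fibre, both relations say that [y] is the value of [g],
   and there are no other pairs, by the first half of [is_fibre_graph]. *)
move=> h' [rh' eh']; apply: extZ; first by rewrite rh rh'.
have [k [k1 k2]] : {k : Hom Q W | w1 ∘ k = h' ∘ a /\ w2 ∘ k = b}.
  by apply: (pullback_lift pbW); rewrite comp_assoc rh' (proj1 pbQ).
have mem' T' (e : Hom T' Q) (y : Hom T' Y) :
    mem (gr ∘ h' ∘ (a ∘ e)) (pair L (b ∘ e) y) <-> y = g ∘ e.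
  have := eev T' (k ∘ e) y.
  by rewrite -(eh' k k1 k2) -k2 -!comp_assoc (comp_assoc h') -k1 -!comp_assoc.
have [gh' _] := graphZ T h'.
rewrite grh; apply: power_ext => T' s xy; rewrite -(pair_eta xy).
by split=> hxy; [have [e _] := (proj1 gR) _ _ _ hxy | have [e _] := gh' _ _ _ hxy];
  move: e hxy; rewrite ?rh' pr1_pair => e;
  have [c [<- <-]] := pullback_lift pbQ (eq_sym e);
  rewrite memR mem'.
Qed.

End Construction.

(** Exponentials in slices are stable under base change: over [u : M -> A], a map
    to the base change of [Z] is a map [M -> Z] over [f u], that is, a map over [I]
    from the product of [f u] and [p] to [Y]; that product is also the product of
    [u] and [p'], so these are the maps over [A] from it to [Y'], that is, the maps
    [M -> Z'] over [u]. *)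
Lemma slice_exp_base_change (L : FiniteLimits C)
  (I X Y Z W : C) (p : Hom X I) (q : Hom Y I) (r : Hom Z I)
  (w1 : Hom W Z) (w2 : Hom W X) (ev : Hom W Y)
  (A X' Y' Z' W' : C) (f : Hom A I) (p' : Hom X' A) (q' : Hom Y' A) (r' : Hom Z' A)
  (w1' : Hom W' Z') (w2' : Hom W' X') (ev' : Hom W' Y')
  (kx : Hom X' X) (ky : Hom Y' Y) :
  is_pullback w1 w2 r p -> is_slice_exp p q r w1 w2 ev ->
  is_pullback w1' w2' r' p' -> is_slice_exp p' q' r' w1' w2' ev' ->
  is_pullback p' kx f p -> is_pullback q' ky f q ->
  exists h : Hom Z' Z, is_pullback r' h f r.
Proof.
move=> pbW [eqv univ] pbW' [eqv' univ'] pbX pbY.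
have pbWX' := pullback_paste pbX pbW'.
have [|h [[rh eh] _]] := univ _ _ (f ∘ r') w1' (kx ∘ w2') pbWX' (ky ∘ ev').
  rewrite comp_assoc -(proj1 pbY) -comp_assoc eqv' comp_assoc (proj1 pbX).
  by rewrite comp_assoc.
have [l [l1 l2]] : {l : Hom W' W | w1 ∘ l = h ∘ w1' /\ w2 ∘ l = kx ∘ w2'}.
  by apply: (pullback_lift pbW); rewrite comp_assoc rh (proj1 pbWX').
have el := eh l l1 l2.
exists h; apply: is_pullback_intro => //.
- move=> M u v e.
  (* [ev k] is the map to [Y] that [v] names, [g'] its lift to [Y'], and [h'] the
     name of [g']. *)
  pose Q := pb u p' L; pose a : Hom Q M := pb1 u p' L; pose b : Hom Q X' := pb2 u p' L.
  have pbQ : is_pullback a b u p' := pb_is_pullback u p' L.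
  have pbQX : is_pullback a (kx ∘ b) (f ∘ u) p := pullback_paste pbX pbQ.
  have [k [k1 k2]] : {k : Hom Q W | w1 ∘ k = v ∘ a /\ w2 ∘ k = kx ∘ b}.
    by apply: (pullback_lift pbW); rewrite comp_assoc -e (proj1 pbQX).
  have eg : q ∘ (ev ∘ k) = p ∘ (kx ∘ b) by rewrite comp_assoc eqv -comp_assoc k2.
  have [g' [g1 g2]] : {g' : Hom Q Y' | q' ∘ g' = p' ∘ b /\ ky ∘ g' = ev ∘ k}.
    by apply: (pullback_lift pbY); rewrite eg !comp_assoc (proj1 pbX).
  have [h' [[rh' eh'] _]] := univ' _ _ _ _ _ pbQ _ g1.
  exists h'; split=> //.
  have [h0 [_ un]] := univ _ _ _ _ _ pbQX _ eg.
  have hv : v = h0.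
    symmetry; apply: un; split=> // k3 k31 k32; congr (_ ∘ _).
    by apply: (pullback_ext pbW); rewrite ?k31 ?k32.
  rewrite hv; symmetry; apply: un; split=> [|k3 k31 k32].
    by rewrite comp_assoc rh -comp_assoc rh'.
  have [k' [k'1 k'2]] : {k' : Hom Q W' | w1' ∘ k' = h' ∘ a /\ w2' ∘ k' = b}.
    by apply: (pullback_lift pbW'); rewrite comp_assoc rh' (proj1 pbQ).
  have -> : k3 = l ∘ k'.
    apply: (pullback_ext pbW); rewrite comp_assoc ?l1 ?l2 -comp_assoc ?k'2 //.
    by rewrite k'1 comp_assoc.
  by rewrite comp_assoc el -comp_assoc (eh' k').
- move=> M u v e1 e2.
  pose Q := pb (r' ∘ u) p' L.
  pose a : Hom Q M := pb1 (r' ∘ u) p' L; pose b : Hom Q X' := pb2 (r' ∘ u) p' L.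
  have pbQ : is_pullback a b (r' ∘ u) p' := pb_is_pullback (r' ∘ u) p' L.
  have [k [k1 k2]] : {k : Hom Q W' | w1' ∘ k = u ∘ a /\ w2' ∘ k = b}.
    by apply: (pullback_lift pbW'); rewrite comp_assoc (proj1 pbQ).
  have eg : q' ∘ (ev' ∘ k) = p' ∘ b by rewrite comp_assoc eqv' -comp_assoc k2.
  have [h0 [_ un]] := univ' _ _ _ _ _ pbQ _ eg.
  have hu : u = h0.
    symmetry; apply: un; split=> // k3 k31 k32; congr (_ ∘ _).
    by apply: (pullback_ext pbW'); rewrite ?k31 ?k32.
  rewrite hu; apply: un; split=> // k3 k31 k32.
  apply: (pullback_ext pbY).
    by rewrite eg comp_assoc eqv' -comp_assoc k32.
  rewrite !comp_assoc -el -!comp_assoc; congr (_ ∘ _).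
  apply: (pullback_ext pbW); rewrite !comp_assoc ?l1 ?l2 -!comp_assoc.
  + by rewrite k31 k1 !comp_assoc e2.
  + by rewrite k32 k2.
Qed.

End SliceExponentials.

(** * Limits in slices *)

(** A cone on [D : J -> C / I] with vertex [w] is a cone in [C] on the extension
    [extend] of [D] to [J] with a terminal object [None] adjoined, sent to [I]; the
    leg at [None] is the structure map of [w]. *)
Section AdjoinTerminal.
Variable J : Category.

Definition adjoin_hom (x y : option J) : Type :=
  match x, y with
  | Some i, Some j => Hom i j
  | _, None => unit
  | None, Some _ => Empty_set
  end.

Definition adjoin_comp (x y z : option J) :
  adjoin_hom y z -> adjoin_hom x y -> adjoin_hom x z :=
  match x, y, z return adjoin_hom y z -> adjoin_hom x y -> adjoin_hom x z with
  | Some _, Some _, Some _ => fun g f => g ∘ f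
  | _, _, None => fun _ _ => tt
  | _, None, Some _ => fun e _ => match e with end
  | None, Some _, Some _ => fun _ e => match e with end
  end.

Definition adjoin_terminal : Category.
Proof.
refine {| Obj := option J; Hom := adjoin_hom;
          idm := fun x => match x return adjoin_hom x x with
                          | Some i => idm i | None => tt end;
          comp := adjoin_comp |}.
- by move=> [i|] [j|] /= f; rewrite ?comp_id_l //; case: f.
- by move=> [i|] [j|] /= f; rewrite ?comp_id_r //; case: f.
- by move=> [i|] [j|] [k|] [m|] /= h g f; rewrite ?comp_assoc //; case: f; case: g.
Defined.

Lemma finite_adjoin_terminal :
  finite_category J -> finite_category adjoin_terminal.
Proof.
move=> [[l hl] hJ]; split.
- exists (None :: map Some l); case=> [i|]; last by left.
  by right; apply: in_map; apply: hl.
- case=> [i|] [j|] /=; first exact: hJ.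
  + by exists (tt :: nil); case; left.
  + by exists nil; case.
  + by exists (tt :: nil); case; left.
Qed.

Variables (C : Category) (I : C) (D : Functor J (slice I)).

Definition extend_fob (x : adjoin_terminal) : C :=
  match x with Some j => sl_dom (D j) | None => I end.

Definition extend_fmap (x y : adjoin_terminal) :
  Hom x y -> Hom (extend_fob x) (extend_fob y) :=
  match x, y return adjoin_hom x y -> Hom (extend_fob x) (extend_fob y) with
  | Some i, Some j => fun u => sl_arr (fmap D u)
  | Some i, None => fun _ => sl_map (D i)
  | None, None => fun _ => idm I
  | None, Some _ => fun e => match e with end
  end.

Definition extend : Functor adjoin_terminal C.
Proof.
refine {| fob := extend_fob; fmap := extend_fmap |}.
- by case=> [i|] //=; rewrite fmap_id.
- move=> [i|] [j|] [k|] //= g f; rewrite ?fmap_comp ?comp_id_l //.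
  by rewrite sl_tri.
Defined.

Definition extend_cone (W : C) (w : Hom W I) (l : forall j, Hom W (sl_dom (D j)))
  (lw : forall j, sl_map (D j) ∘ l j = w)
  (ln : forall i j (u : Hom i j), sl_arr (fmap D u) ∘ l i = l j) : Cone extend.
Proof.
refine (@Build_Cone _ _ extend W (fun x : adjoin_terminal =>
  match x return Hom W (extend_fob x) with Some j => l j | None => w end) _).
by move=> [i|] [j|] //= u; rewrite comp_id_l.
Defined.

Section SliceLimit.
Variable l : Limit extend.

Lemma leg_slice (j : J) : sl_map (D j) ∘ leg l (Some j) = leg l None.
Proof. exact: (leg_nat l (i := Some j) (j := None) tt). Qed.

Lemma leg_slice_nat (i j : J) (u : Hom i j) :
  sl_arr (fmap D u) ∘ leg l (Some i) = leg l (Some j).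
Proof. exact: (leg_nat l (i := Some i) (j := Some j) u). Qed.

Definition slice_limit_vertex : slice I := Build_SliceObj (leg l None).

Definition slice_limit_leg (j : J) : Hom slice_limit_vertex (D j) :=
  @Build_SliceHom _ _ slice_limit_vertex (D j) _ (leg_slice j).

Lemma slice_limit_leg_nat (i j : J) (u : Hom i j) :
  fmap D u ∘ slice_limit_leg i = slice_limit_leg j.
Proof. by apply: slice_hom_eq; exact: leg_slice_nat. Qed.

Definition slice_limit_cone : Cone D := Build_Cone slice_limit_leg_nat.

Definition slice_cone_extend (c : Cone D) : Cone extend :=
  extend_cone (fun j => sl_tri (leg c j))
    (fun i j u => f_equal (@sl_arr _ _ _ _) (leg_nat c u)).

Definition slice_limit : Limit D.
Proof.
refine {| lim_cone := slice_limit_cone;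
  lim_med := fun c => @Build_SliceHom _ _ (vertex c) (vertex slice_limit_cone) _
    (lim_med_leg l (slice_cone_extend c) None) |}.
- move=> c j; apply: slice_hom_eq.
  exact: (lim_med_leg l (slice_cone_extend c) (Some j)).
- move=> c h e; apply: slice_hom_eq.
  apply: (lim_med_uniq (c := slice_cone_extend c)).
  case=> [j|]; last exact: (sl_tri h).
  by exact: (f_equal (@sl_arr _ _ _ _) (e j)).
Defined.

End SliceLimit.

End AdjoinTerminal.

Definition slice_finite_limits (C : Category) (L : FiniteLimits C) (I : C) :
  FiniteLimits (slice I) :=
  fun J hJ D => slice_limit (L _ (finite_adjoin_terminal hJ) (extend D)).

(** Finite limits in slices are stable under base change. The pullbacks [x j] of
    the objects of the diagram are arbitrary, since they have to be chosen with
    their domains in a given class, so their functoriality comes from the universal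
    property. *)
Section DiagramBaseChange.
Variables (C J : Category) (I A : C) (f : Hom A I) (D : Functor J (slice I)).
Variables (x : J -> slice A) (k : forall j, Hom (sl_dom (x j)) (sl_dom (D j))).
Hypothesis pbk : forall j, is_pullback (sl_map (x j)) (k j) f (sl_map (D j)).

Definition base_change_lift i j (u : Hom i j) :
  {v : Hom (sl_dom (x i)) (sl_dom (x j)) |
    sl_map (x j) ∘ v = sl_map (x i) /\ k j ∘ v = sl_arr (fmap D u) ∘ k i}.
Proof.
apply: (pullback_lift (pbk j)).
by rewrite comp_assoc sl_tri (proj1 (pbk i)).
Qed.

Definition base_change_map i j (u : Hom i j) : Hom (x i) (x j) :=
  Build_SliceHom (proj1 (proj2_sig (base_change_lift u))).

Lemma base_change_mapE i j (u : Hom i j) :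
  k j ∘ sl_arr (base_change_map u) = sl_arr (fmap D u) ∘ k i.
Proof. exact: proj2 (proj2_sig (base_change_lift u)). Qed.

Lemma base_change_map_ext i j (u v : Hom (x i) (x j)) :
  k j ∘ sl_arr u = k j ∘ sl_arr v -> u = v.
Proof.
move=> e; apply: slice_hom_eq; apply: (pullback_ext (pbk j)) => //.
by rewrite !sl_tri.
Qed.

Definition base_change_diagram : Functor J (slice A).
Proof.
refine {| fob := x : J -> slice A; fmap := base_change_map |}.
- move=> j; apply: base_change_map_ext.
  by rewrite base_change_mapE fmap_id /= comp_id_l comp_id_r.
- move=> i j m v u; apply: base_change_map_ext; rewrite base_change_mapE /=.
  by rewrite comp_assoc base_change_mapE -comp_assoc base_change_mapE fmap_comp comp_assoc.
Defined.

Lemma slice_limit_base_change (l : Limit (extend D))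
  (l' : Limit (extend base_change_diagram)) :
  exists h, is_pullback (leg l' None) h f (leg l None).
Proof.
have tri j : sl_map (D j) ∘ (k j ∘ leg l' (Some j)) = f ∘ leg l' None
  by rewrite comp_assoc -(proj1 (pbk j)) -comp_assoc (leg_slice l').
have nat i j (u : Hom i j) :
    sl_arr (fmap D u) ∘ (k i ∘ leg l' (Some i)) = k j ∘ leg l' (Some j)
  by rewrite comp_assoc -base_change_mapE -comp_assoc (leg_slice_nat l').
pose h := lim_med l (extend_cone tri nat).
have hN : leg l None ∘ h = f ∘ leg l' None
  by exact: (lim_med_leg l (extend_cone tri nat) None).
have hS j : leg l (Some j) ∘ h = k j ∘ leg l' (Some j)
  by exact: (lim_med_leg l (extend_cone tri nat) (Some j)).
exists h; apply: is_pullback_intro => // [W a b e|W u v e1 e2].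
- have lift j : {c | sl_map (x j) ∘ c = a /\ k j ∘ c = leg l (Some j) ∘ b}.
    by apply: (pullback_lift (pbk j)); rewrite e comp_assoc (leg_slice l).
  pose c j := proj1_sig (lift j).
  have cE j : sl_map (x j) ∘ c j = a /\ k j ∘ c j = leg l (Some j) ∘ b
    by exact: proj2_sig (lift j).
  have cnat i j (u : Hom i j) : sl_arr (base_change_map u) ∘ c i = c j.
    apply: (pullback_ext (pbk j)).
      by rewrite comp_assoc sl_tri (proj1 (cE i)) (proj1 (cE j)).
    rewrite comp_assoc base_change_mapE -comp_assoc (proj2 (cE i)) (proj2 (cE j)).
    by rewrite comp_assoc (leg_slice_nat l).
  pose ec := extend_cone (D := base_change_diagram) (fun j => proj1 (cE j)) cnat.
  have uN : leg l' None ∘ lim_med l' ec = a by exact: (lim_med_leg l' ec None).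
  have uS j : leg l' (Some j) ∘ lim_med l' ec = c j
    by exact: (lim_med_leg l' ec (Some j)).
  exists (lim_med l' ec); split=> //.
  apply: limit_ext; case=> [j|].
    by rewrite comp_assoc hS -comp_assoc uS (proj2 (cE j)).
  by rewrite comp_assoc hN -comp_assoc uN.
- apply: limit_ext; case=> [j|] //.
  apply: (pullback_ext (pbk j)); first by rewrite !comp_assoc (leg_slice l').
  by rewrite !comp_assoc -hS -!comp_assoc e2.
Qed.

End DiagramBaseChange.

(** * The slices of a topos *)

Lemma closed_under_all (C : Category) (S : ToposStructure C) :
  closed_under S (fun _ => True).
Proof. by []. Qed.

Section SliceTopos.
Variables (C : Category) (S : ToposStructure C) (I : C).
Let L := ts_lim S.
Let LI := @slice_finite_limits C L I.

Lemma slice_prod_pullback (x y : slice I) :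
  is_pullback (sl_arr (pr1 LI x y)) (sl_arr (pr2 LI x y)) (sl_map x) (sl_map y).
Proof.
apply: is_pullback_intro; first by rewrite !sl_tri.
- move=> W h k e.
  pose w : slice I := Build_SliceObj (sl_map x ∘ h).
  pose h' : Hom w x := @Build_SliceHom _ _ w x h (eq_refl _).
  pose k' : Hom w y := @Build_SliceHom _ _ w y k (eq_sym e).
  exists (sl_arr (pair LI h' k')); split.
  + exact: (f_equal (@sl_arr _ _ _ _) (pr1_pair LI h' k')).
  + exact: (f_equal (@sl_arr _ _ _ _) (pr2_pair LI h' k')).
- move=> W u v e1 e2.
  pose w : slice I := Build_SliceObj (sl_map (prod LI x y) ∘ u).
  have ev : sl_map (prod LI x y) ∘ v = sl_map (prod LI x y) ∘ u
    by rewrite -(sl_tri (pr1 LI x y)) -!comp_assoc e1.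
  pose u' : Hom w (prod LI x y) :=
    @Build_SliceHom _ _ w (prod LI x y) u (eq_refl _).
  pose v' : Hom w (prod LI x y) := @Build_SliceHom _ _ w (prod LI x y) v ev.
  have e : u' = v' by apply: prod_ext; apply: slice_hom_eq.
  exact: (f_equal (@sl_arr _ _ _ _) e).
Qed.

Definition slice_exp_data (x y : slice I) :
  {z : slice I & {ev : Hom (prod LI z x) y |
    is_slice_exp (sl_map x) (sl_map y) (sl_map z)
      (sl_arr (pr1 LI z x)) (sl_arr (pr2 LI z x)) (sl_arr ev)}}.
Proof.
have ex : exists z : slice I, exists ev : Hom (prod LI z x) y,
    is_slice_exp (sl_map x) (sl_map y) (sl_map z)
      (sl_arr (pr1 LI z x)) (sl_arr (pr2 LI z x)) (sl_arr ev).
  have [Z [r [_ ax]]] := slice_exp_exists (closed_under_all S) (sl_map x) (sl_map y)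
    Logic.I Logic.I Logic.I.
  pose z : slice I := Build_SliceObj r.
  have [ev hev] := ax _ _ _ (slice_prod_pullback z x).
  have tri : sl_map y ∘ ev = sl_map (prod LI z x).
    by rewrite (proj1 hev) -(sl_tri (pr2 LI z x)).
  by exists z, (@Build_SliceHom _ _ (prod LI z x) y ev tri).
have [z hz] := constructive_indefinite_description _ ex.
by exists z; apply: constructive_indefinite_description.
Qed.

Definition slice_exp (x y : slice I) : slice I := projT1 (slice_exp_data x y).

Definition slice_ev (x y : slice I) : Hom (prod LI (slice_exp x y) x) y :=
  proj1_sig (projT2 (slice_exp_data x y)).

Lemma slice_evP (x y : slice I) :
  is_slice_exp (sl_map x) (sl_map y) (sl_map (slice_exp x y))
    (sl_arr (pr1 LI (slice_exp x y) x)) (sl_arr (pr2 LI (slice_exp x y) x))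
    (sl_arr (slice_ev x y)).
Proof. exact: proj2_sig (projT2 (slice_exp_data x y)). Qed.

Lemma slice_exp_univ (x y w : slice I) (g : Hom (prod LI w x) y) :
  exists! h : Hom w (slice_exp x y), slice_ev x y ∘ prod_map_l LI x h = g.
Proof.
have [_ univ] := slice_evP x y.
have eg : sl_map y ∘ sl_arr g = sl_map x ∘ sl_arr (pr2 LI w x) by rewrite !sl_tri.
have mapE (h : Hom w (slice_exp x y)) :
    sl_arr (pr1 LI _ x) ∘ sl_arr (prod_map_l LI x h)
      = sl_arr h ∘ sl_arr (pr1 LI w x) /\
    sl_arr (pr2 LI _ x) ∘ sl_arr (prod_map_l LI x h) = sl_arr (pr2 LI w x).
  split; [set e := pr1_pair LI (h ∘ pr1 LI w x) (pr2 LI w x)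
         |set e := pr2_pair LI (h ∘ pr1 LI w x) (pr2 LI w x)];
    exact: (f_equal (@sl_arr _ _ _ _) e).
have [h [[rh eh] un]] := univ _ _ _ _ _ (slice_prod_pullback w x) _ eg.
pose h' : Hom w (slice_exp x y) := @Build_SliceHom _ _ w (slice_exp x y) h rh.
exists h'; split.
  apply: slice_hom_eq; have [e1 e2] := mapE h'; exact: eh.
move=> v ev; apply: slice_hom_eq; apply: un; split=> [|k k1 k2]; first exact: sl_tri.
rewrite -ev /=; congr (_ ∘ _); have [e1 e2] := mapE v.
by apply: (pullback_ext (slice_prod_pullback _ x)); rewrite ?k1 ?k2.
Qed.

Definition slice_omega : slice I := Build_SliceObj (pr1 L I (ts_omega S)).

Definition slice_true : Hom (terminal LI) slice_omega :=
  @Build_SliceHom _ _ (terminal LI) slice_omega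
    (pair L (sl_map (terminal LI)) (truth S _)) (pr1_pair _ _ _).

(** A map to [I * Omega] over [I] carries no more information than its second
    component. *)
Lemma slice_true_eq (x w : slice I) (chi : Hom x slice_omega) (h : Hom w x)
  (k : Hom w (terminal LI)) :
  chi ∘ h = slice_true ∘ k <->
  pr2 L I (ts_omega S) ∘ sl_arr chi ∘ sl_arr h = truth S (sl_dom w).
Proof.
have e2 : pr2 L I (ts_omega S) ∘ sl_arr (slice_true ∘ k) = truth S (sl_dom w).
  by rewrite /= comp_assoc pr2_pair truth_comp.
split=> [e|e].
- by rewrite -e2 -e /= comp_assoc.
- apply: slice_hom_eq; apply: prod_ext; last by rewrite e2 -e /= comp_assoc.
  have := sl_tri (chi ∘ h); rewrite -(sl_tri (slice_true ∘ k)); exact.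
Qed.

Lemma slice_classify (u x : slice I) (m : Hom u x) (chi : Hom x slice_omega) :
  is_mono (sl_arr m) ->
  is_pullback m (bang LI u) chi slice_true <->
  is_pullback (sl_arr m) (bang L (sl_dom u)) (pr2 L I (ts_omega S) ∘ sl_arr chi)
    (ts_true S).
Proof.
move=> mm; rewrite omega_classify; split=> [pb|[_ ax]].
- split=> // T s; split=> [e|[c <-]].
  + pose w : slice I := Build_SliceObj (sl_map x ∘ s).
    pose s' : Hom w x := @Build_SliceHom _ _ w x s (eq_refl _).
    have [c [ec _]] := pullback_lift (h := s') pb
      (proj2 (slice_true_eq chi s' (bang LI w)) e).
    by exists (sl_arr c); rewrite -[s]/(sl_arr s') -ec.
  + rewrite comp_assoc; have := proj1 (slice_true_eq _ _ _) (proj1 pb) => ->.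
    exact: truth_comp.
- apply: is_pullback_intro.
  + by apply/slice_true_eq/ax; exists (idm _); rewrite comp_id_r.
  + move=> w h k /slice_true_eq /ax [c ec].
    have tri : sl_map u ∘ c = sl_map w by rewrite -(sl_tri m) -comp_assoc ec sl_tri.
    exists (@Build_SliceHom _ _ w u c tri); split; last exact: bang_ext.
    exact: slice_hom_eq.
  + move=> w v v' e _; apply: slice_hom_eq; apply: mm.
    exact: (f_equal (@sl_arr _ _ _ _) e).
Qed.

Lemma slice_omega_univ (u x : slice I) (m : Hom u x) : is_mono m ->
  exists! chi : Hom x slice_omega, is_pullback m (bang LI u) chi slice_true.
Proof.
move=> mm.
have {}mm : is_mono (sl_arr m).
  move=> W v v' e.
  pose w : slice I := Build_SliceObj (sl_map u ∘ v).
  have tri : sl_map u ∘ v' = sl_map w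
    by rewrite /w /= -(sl_tri m) -!comp_assoc e.
  pose v1 : Hom w u := @Build_SliceHom _ _ w u v (eq_refl _).
  pose v2 : Hom w u := @Build_SliceHom _ _ w u v' tri.
  have e12 : v1 = v2 by apply: mm; apply: slice_hom_eq.
  exact: (f_equal (@sl_arr _ _ _ _) e12).
have [chi [pb un]] := ts_omega_univ S mm.
exists (@Build_SliceHom _ _ x slice_omega (pair L (sl_map x) chi) (pr1_pair _ _ _)).
split; first by apply/slice_classify; rewrite //= pr2_pair.
move=> chi' /(slice_classify _ mm) /un e; apply: slice_hom_eq.
apply: prod_ext => /=; rewrite ?pr1_pair ?pr2_pair //.
by have := sl_tri chi' => <-.
Qed.

Definition slice_topos : ToposStructure (slice I) :=
  {| ts_lim := LI; ts_exp := slice_exp; ts_ev := slice_ev;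
     ts_exp_univ := slice_exp_univ; ts_omega := slice_omega;
     ts_true := slice_true; ts_omega_univ := slice_omega_univ |}.

End SliceTopos.

(** * Locally small maps *)

Section LocallySmall.
Variables (C : Category) (S : ToposStructure C) (E : C -> Prop).
Hypothesis closed : closed_under S E.
Let L := ts_lim S.

(** Given [g : A' -> A], a pullback of [p] along [f g] is also a pullback of [q]
    along [g], by the cancellation law for pullback squares. *)
Lemma locally_small_pullback (X B A V : C) (p : Hom X B) (f : Hom A B)
  (q : Hom V A) (k : Hom V X) :
  locally_small E p -> is_pullback q k f p -> locally_small E q.
Proof.
move=> hp pb A' g hA'.
have [W [q' [l [hW pbW]]]] := hp _ (f ∘ g) hA'.
have [|c [c1 c2]] := pullback_lift (h := g ∘ q') (k := l) pb.
  by rewrite comp_assoc (proj1 pbW).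
exists W, q', c; split=> //; apply: is_pullback_intro => //.
- move=> T a b e.
  have [|d [d1 d2]] := pullback_lift (h := a) (k := k ∘ b) pbW.
    by rewrite -comp_assoc e !comp_assoc (proj1 pb).
  exists d; split=> //; apply: (pullback_ext pb).
  + by rewrite comp_assoc c1 -comp_assoc d1.
  + by rewrite comp_assoc c2.
- by move=> T u v e1 e2; apply: (pullback_ext pbW) => //;
    rewrite -c2 -!comp_assoc e2.
Qed.

Lemma locally_small_comp (X Y Z : C) (p : Hom X Y) (q : Hom Y Z) :
  locally_small E p -> locally_small E q -> locally_small E (q ∘ p).
Proof.
move=> hp hq A f hA.
have [V [q' [k [hV pbV]]]] := hq _ f hA.
have [W [p' [l [hW pbW]]]] := hp _ k hV.
exists W, (q' ∘ p'), l; split=> //.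
exact: (is_pullback_sym (pullback_paste (is_pullback_sym pbV) (is_pullback_sym pbW))).
Qed.

Lemma locally_small_iso (X Y : C) (u : Hom X Y) : is_iso u -> locally_small E u.
Proof.
move=> [v [vu uv]] A f hA; exists A, (idm A), (v ∘ f); split=> //.
apply: is_pullback_intro.
- by rewrite comp_assoc uv comp_id_l comp_id_r.
- move=> W h k e; exists h; rewrite comp_id_l; split=> //.
  by rewrite -comp_assoc e comp_assoc vu comp_id_l.
- by move=> W a b; rewrite !comp_id_l.
Qed.

Lemma locally_small_display : is_display_class (locally_small E).
Proof.
split; last split; last split.
- move=> X' X B p u hu hp; exact: locally_small_comp (locally_small_iso hu) hp.
- move=> X B B' p v hv hp; exact: locally_small_comp hp (locally_small_iso hv).
- move=> X B A p f _; exists (pb f p L), (pb1 f p L), (pb2 f p L).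
  exact: pb_is_pullback.
- move=> X B A V p f q k; exact: locally_small_pullback.
Qed.

(** Pull the diagram back along [f] with domains in [E]; the limit of the result is
    a limit in [C] of objects of [E], namely those domains and [A]. *)
Lemma locally_small_slice_lim (I : C) (J : Category) (hJ : finite_category J)
  (D : Functor J (slice I)) :
  (forall j, class_fiber (locally_small E) (D j)) ->
  class_fiber (locally_small E) (vertex (slice_finite_limits L hJ D)).
Proof.
move=> hD A f hA.
have small j : {x : slice A & {k : Hom (sl_dom x) (sl_dom (D j)) |
    E (sl_dom x) /\ is_pullback (sl_map x) k f (sl_map (D j))}}.
  have ex : exists x : slice A, exists k : Hom (sl_dom x) (sl_dom (D j)),
      E (sl_dom x) /\ is_pullback (sl_map x) k f (sl_map (D j)).
    by have [V [q [k hk]]] := hD j A f hA; exists (Build_SliceObj q), k.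
  have [x hx] := constructive_indefinite_description _ ex.
  by exists x; apply: constructive_indefinite_description.
pose x j := projT1 (small j); pose k j := proj1_sig (projT2 (small j)).
have Ex j : E (sl_dom (x j)) := proj1 (proj2_sig (projT2 (small j))).
have pbx j : is_pullback (sl_map (x j)) (k j) f (sl_map (D j))
  := proj2 (proj2_sig (projT2 (small j))).
pose l' := L (finite_adjoin_terminal hJ) (extend (base_change_diagram pbx)).
have [h pbh] := slice_limit_base_change (L (finite_adjoin_terminal hJ) (extend D)) l'.
exists (vertex l'), (leg l' None), h; split=> //.
by apply: (proj1 closed); case.
Qed.

(** The exponential over [A] of the pullbacks along [f] can be taken with domain in
    [E], by [slice_exp_exists] for the class [E], and it is a pullback of the
    exponential over [I]. *)
Lemma locally_small_slice_exp (I : C) (x y : slice I) :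
  class_fiber (locally_small E) x -> class_fiber (locally_small E) y ->
  class_fiber (locally_small E) (slice_exp S x y).
Proof.
move=> hx hy A f hA.
have [X' [p' [kx [hX' pbX]]]] := hx A f hA.
have [Y' [q' [ky [hY' pbY]]]] := hy A f hA.
have [Z' [r' [hZ' ax]]] := slice_exp_exists closed p' q' hA hX' hY'.
have pbW := pb_is_pullback r' p' L.
have [ev' hev'] := ax _ _ _ pbW.
have [h pbh] := slice_exp_base_change L (slice_prod_pullback S _ x) (slice_evP S x y)
  pbW hev' pbX pbY.
by exists Z', r', h.
Qed.

(** The pullback of the projection [I * Omega -> I] along [f] is [A * Omega -> A],
    and [Omega] is in [E]. *)
Lemma locally_small_slice_omega (I : C) :
  class_fiber (locally_small E) (slice_omega S I).
Proof.
move=> A f hA.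
exists (prod L A (ts_omega S)), (pr1 L _ _), (prod_map_l L _ f); split.
  by apply: (closed_prod closed) => //; apply: (proj2 (proj2 closed)).
apply: is_pullback_intro; first by rewrite /= pr1_pair.
- move=> W h k e; exists (pair L h (pr2 L _ _ ∘ k)); rewrite pr1_pair; split=> //.
  rewrite /prod_map_l pair_comp -comp_assoc pr1_pair pr2_pair e; exact: pair_eta.
- move=> W u v e; rewrite /prod_map_l !pair_comp => /pair_inj [_ e2].
  exact: prod_ext.
Qed.

Lemma locally_small_logical (I : C) :
  is_logical_subtopos (class_fiber (locally_small E) (I := I)).
Proof.
exists (slice_topos S I); split; first exact: locally_small_slice_lim.
split; [exact: locally_small_slice_exp | exact: locally_small_slice_omega].
Qed.

End LocallySmall.

Theorem corollary2p18 (F : Topos) (E : F -> Prop)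
  (hE : is_dense_logical_subtopos E)
  (hgen : has_generic (locally_small E)) :
  is_impredicative_universe (locally_small E).
Proof.
have [[S closed] _] := hE.
split; first exact: locally_small_display S E.
split; first by move=> X Y Z p q; exact: locally_small_comp.
split=> //; split; first exact: locally_small_logical closed.
move=> I J f x hx; apply: (locally_small_pullback hx); exact: pb_is_pullback.
Qed.
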